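(* Let $n\ge 3$ be an integer and let $$\alpha_n=\frac{(18n^2-18n)^{1/2}-3n+1}{9n^2-12n-1}.$$ If $\alpha_n<\lambda\le \frac{1}{6n-4}$, then the Banach space $X_\lambda=(\mathbb{R}^n,\mathcal{N}_\lambda)$ is isometric to a subspace of $L_{1/2}$, and, at the same time, $X_\lambda$ is not isometric to a subspace of $L_1$.
   Context: All spaces are real. For $\lambda>0$ the function $\mathcal{N}_\lambda$ on $\mathbb{R}^n$ is defined by $\mathcal{N}_\lambda(0)=0$ and, for $x\neq 0$, $$\mathcal{N}_\lambda(x)=(x_1^2+\dots+x_n^2)^{1/2}\Big(1+\lambda\,\frac{x_1^2+\dots+x_{n-1}^2-2x_n^2}{x_1^2+\dots+x_n^2}\Big)^2 .$$ For $0<\lambda\le \frac1{11}$ this function is a norm on $\mathbb{R}^n$, and $X_\lambda$ denotes $\mathbb{R}^n$ with the norm $\mathcal{N}_\lambda$; for $n\ge 3$ one has $\frac{1}{6n-4}<\frac1{11}$. For $q>0$, $L_q=L_q([0,1])$ with Lebesgue measure and $\|f\|_q=\big(\int_0^1|f(t)|^q\,dt\big)^{1/q}$ (a quasi-norm when $q<1$). A normed space $(X,\|\cdot\|)$ is isometric to a subspace of $L_q$ if there is a linear map $T:X\to L_q$ with $\|Tx\|_q=\|x\|$ for all $x\in X$. *)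

(* Defs.v *)
From HB Require Import structures.
From mathcomp Require Import all_boot all_order all_algebra.
From mathcomp Require Import all_classical all_reals all_analysis.

Set Implicit Arguments.
Unset Strict Implicit.
Unset Printing Implicit Defensive.

Import Order.TTheory GRing.Theory Num.Theory.
Import numFieldNormedType.Exports.

Local Open Scope classical_set_scope.
Local Open Scope ring_scope.

(* For n > 0 the second sum has exactly one term, the square of the last
   coordinate. *)
Definition calN (R : realType) (n : nat) (lam : R) (x : 'rV[R]_n) : R :=
  if x == 0 then 0 else
  Num.sqrt (\sum_(i < n) x 0 i ^+ 2) *
  (1 + lam * ((\sum_(i < n | (i.+1 < n)%N) x 0 i ^+ 2
               - 2 * \sum_(i < n | i.+1 == n :> nat) x 0 i ^+ 2)
              / \sum_(i < n) x 0 i ^+ 2)) ^+ 2.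

Definition alpha (R : realType) (n : nat) : R :=
  (Num.sqrt (18 * n%:R ^+ 2 - 18 * n%:R) - 3 * n%:R + 1)
  / (9 * n%:R ^+ 2 - 12 * n%:R - 1).

(* Lebesgue measure on [0, 1], carried by the whole line: functions are
   identified when they agree almost everywhere on [0, 1]. *)
Definition lebesgue01 (R : realType) :
    {measure set (measurableTypeR R) -> \bar R} :=
  mrestr (@lebesgue_measure R) (measurable_itv `[(0 : R), 1]).

(* The linear map into L_q is given by a choice of representatives T x, so it
   is linear modulo almost everywhere equality. *)
Definition isometric_to_subspace_of_L (R : realType) (q : R)
    (V : lmodType R) (N : V -> R) : Prop :=
  exists T : V -> measurableTypeR R -> R,
    [/\ forall x, T x \in Lfun (lebesgue01 R) q%:E,
        forall (a : R) x y,
          T (a *: x + y) = (fun t => a * T x t + T y t) %[ae lebesgue01 R]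
      & forall x, ('N[lebesgue01 R]_q%:E[EFin \o T x] = (N x)%:E)%E].

(* Main.v *)
From HB Require Import structures.
Require Import Defs.
From mathcomp Require Import all_boot all_order all_algebra.
From mathcomp Require Import ring lra.
From mathcomp Require Import all_classical all_reals all_analysis.
From mathcomp Require Import measurable_realfun.

(** Write [N] for the dimension, [u] for the squared cosine of the angle between
    [x] and the last axis, and [|x|] for the Euclidean norm, so that the norm under
    study is [|x| (1 + lam - 3 lam u)^2].  Both halves compute with a standard
    Gaussian vector [g].

    Embedding into [L_{1/2}].  For nonnegative weights [w_i] put
    [T x = (sum_i w_i g_i^2)^2 <x, g>], so that [|T x|^{1/2}] is
    [|<x, g>|^{1/2} sum_i w_i g_i^2].  A second moment computation
    ([dot_moment2]) shows that its integral is a multiple of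
    [|x|^{1/2} sum_i w_i (1 + x_i^2 / (2 |x|^2))].  Equal weights, except for the
    last one, give every affine function of [u], in particular [1 + lam - 3 lam u],
    and the last weight is nonnegative exactly when [lam <= 1 / (6 N - 4)].  It
    remains to realise [g] on the unit interval ([gaussian_vector_exists]): the
    binary digits of a uniform number split into two independent uniform numbers,
    the quantile function turns one of them into a Gaussian variable, and linear
    forms are handled by the invariance of the Gaussian plane under rotations.

    No embedding into [L_1].  The same kind of computation writes the norm as the
    integral of [q(g) |<x, g>|] for a signed quartic form
    [q(y) = A |y|^4 + B |y|^2 y_N^2 + D y_N^4].  At the pole it takes the value
    [A + B + D], a positive multiple of
    [1 - (6 N - 2) lam - (9 N^2 - 12 N - 1) lam^2], which is negative because
    [alpha < lam].  An embedding into [L_1] would write the norm as the integral of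
    [|<x, xi>|] for a random vector [xi], that is, with a nonnegative weight.  To
    compare the two, integrate both against the Hermite polynomial of degree [2 k]
    in the last coordinate of an independent Gaussian vector placed at [x]: by a
    Funk-Hecke formula ([hermite_dot]) the kernel [|<x, y>|] becomes a nonzero
    constant times [|y| v(y)^k], where [v(y)] is the squared cosine of the angle
    between [y] and the last axis.  So the integral of [q(g) |g| v(g)^k] is that of
    [|xi| v(xi)^k], hence nonnegative, for every [k]
    ([test_against_representation]).  But for large [k] the function [v^k]
    concentrates at the pole, where [q] is negative ([zonal_concentration]). *)

Set Implicit Arguments.
Unset Strict Implicit.
Unset Printing Implicit Defensive.

Import Order.TTheory GRing.Theory Num.Theory.
Import numFieldNormedType.Exports.

Local Open Scope classical_set_scope.
Local Open Scope ring_scope.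

(** * Measures on the line *)

Section push.
Context d d' (T : measurableType d) (T' : measurableType d') (R : realType).
Variables (m : {measure set T -> \bar R}) (f : T -> T').
Hypothesis mf : measurable_fun [set: T] f.

Definition push_measure : {measure set T' -> \bar R} :=
  (fun h : {measure set T' -> \bar R} => h) (ltac:(refine (pushforward m f); exact: mf)).

End push.

Section affine.
Context {R : realType}.
Local Notation mu := (@lebesgue_measure R).

Lemma lebesgue_measure_affine (k c : R) (A : set R) : 0 < k -> measurable A ->
  mu ((fun t => k * t + c) @^-1` A) = (k^-1%:E * mu A)%E.
Proof.
move=> k0 mA.
have mf : @measurable_fun _ _ (measurableTypeR R) (measurableTypeR R) setT
    (fun t : R => k * t + c).
  suff : measurable_fun [set: R] (fun t : R => k * t + c) by [].
  by apply: measurable_funD => //; exact: measurable_funM.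
pose nu : {measure set (measurableTypeR R) -> \bar R} :=
  mscale (NngNum (ltW k0)) (push_measure mu mf).
rewrite (@lebesgue_measure_unique R nu _ _ mA); first last.
  move=> X [[a b] _ <-] /=.
  rewrite /nu /mscale /= /push_measure /pushforward /=.
  have -> : (fun t => k * t + c) @^-1` `]a, b] = `](a - c) / k, (b - c) / k]%classic.
    apply/seteqP; split => t /=; rewrite !in_itv/=;
    by rewrite ltr_pdivrMr// ler_pdivlMr// ltrBlDr lerBrDr (mulrC t).
  rewrite !lebesgue_measure_itv/= !lte_fin ltr_pM2r ?invr_gt0// ltrD2r.
  case: ifPn => ab; last by rewrite mule0.
  by rewrite -EFinB -!EFinM; congr EFin; field; rewrite gt_eqF.
by rewrite /nu /mscale /push_measure /= /pushforward muleA -EFinM mulVf ?mul1e// gt_eqF.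
Qed.

End affine.

Section unif.
Context {R : realType}.

Let setT1 : (lebesgue01 R : set (measurableTypeR R) -> \bar R) [set: measurableTypeR R] = 1%E.
Proof.
by rewrite /lebesgue01/= /mrestr setTI lebesgue_measure_itv/= lte_fin ltr01 oppr0 adde0.
Qed.

(** The measure [lebesgue01] with its total mass recorded.  Integrals against the
    two are convertible, so that the moments of [unif01] are the integrals in the
    quasi-norms of the [L_q] spaces. *)
Definition unif01 : probability (measurableTypeR R) R :=
  HB.pack (Measure.sort (lebesgue01 R)) (Measure.class (lebesgue01 R))
   (Measure_isProbability.Build _ _ _ (lebesgue01 R) setT1).

Lemma unif01E (A : set (measurableTypeR R)) : unif01 A = lebesgue_measure (A `&` `[0, 1]).
Proof. by []. Qed.

End unif.

Section rays.
Context {R : realType}.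

(** The open rays form a class stable under intersection that generates the Borel
    sets, and they exhaust the line. *)
Lemma ray_measure_unique (m1 m2 : {measure set (measurableTypeR R) -> \bar R}) :
  (m1 setT < +oo)%E ->
  (forall a : R, m1 `]a, +oo[%classic = m2 `]a, +oo[%classic) ->
  forall A, measurable A -> m1 A = m2 A.
Proof.
move=> fin1 m12 A mA.
apply: (@measure_unique _ R (measurableTypeR R) (@RGenOInfty.G R)
  (fun k => `](- k%:R), +oo[%classic)) => //.
- exact: RGenOInfty.measurableE.
- move=> _ _ [x ->] [y ->]; exists (Num.max x y).
  by apply/seteqP; split=> t /=; rewrite !in_itv/= !andbT gt_max => /andP.
- by move=> k; exists (- k%:R).
- rewrite -subTset => x _; exists (Num.truncn `|x|).+1 => //=.
  by rewrite in_itv/= andbT ltrNl (le_lt_trans (ler_norm _))// normrN truncnS_gt.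
- by move=> _ [x ->].
- move=> k; apply: le_lt_trans fin1; apply: le_measure; rewrite ?inE//=.
Qed.

End rays.

Section split_uniform.
Context {R : realType}.
Local Notation P := (@unif01 R).
Local Notation mu := (@lebesgue_measure R).

(** Given the first binary digit of a uniform number, the number formed by the
    other digits is again uniform. *)
Lemma unif01_split (A0 A1 : set R) : measurable A0 -> measurable A1 ->
  P [set t | if t < 2^-1 then A0 (2 * t) else A1 (2 * t - 1)] =
  (2^-1%:E * P A0 + 2^-1%:E * P A1)%E.
Proof.
move=> mA0 mA1; rewrite !unif01E.
have m01o : measurable (`[0, 1[%classic : set R) by exact: measurable_itv.
have m01c : measurable (`[0, 1]%classic : set R) by exact: measurable_itv.
have -> : mu (A0 `&` `[0, 1]) = mu (A0 `&` `[0, 1[).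
  have -> : A0 `&` `[0, 1] = (A0 `&` `[0, 1[) `|` (A0 `&` [set 1]).
    rewrite -setIUr; congr (_ `&` _); apply/seteqP; split => t /=; rewrite !in_itv/=.
      by case/andP=> t0; rewrite le_eqVlt => /orP[/eqP ->|t1]; [right|left; rewrite t0].
    by case=> [/andP[-> /ltW ->//]|->]; rewrite ler01 lexx.
  apply: measureU0; [exact: measurableI|exact: measurableI|].
  apply/eqP; rewrite eq_le measure_ge0 andbT.
  by rewrite -(lebesgue_measure_set1 (1 : R)) le_measure ?inE//; exact: measurableI.
have m0 := @lebesgue_measure_affine R 2 0 (A0 `&` `[0, 1[) ltac:(by []) (measurableI _ _ mA0 m01o).
have m1 := @lebesgue_measure_affine R 2 (- 1) (A1 `&` `[0, 1]) ltac:(by []) (measurableI _ _ mA1 m01c).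
rewrite -[X in (_ = X + _)%E]m0 -[X in (_ = _ + X)%E]m1.
have maff (c : R) : measurable_fun [set: R] (fun t : R => 2 * t + c).
  by apply: measurable_funD => //; exact: measurable_funM.
rewrite -measureU//; clear m0 m1; first last.
- apply/(@seteqP R); split => t //=; rewrite !in_itv/= addr0 => -[[_ /andP[_ ?]] [_ /andP[? _]]]; lra.
- rewrite -[X in measurable X]setTI; apply: maff => //; exact: measurableI.
- rewrite -[X in measurable X]setTI; apply: maff => //; exact: measurableI.
congr (mu _); apply/(@seteqP R); split => t /=; rewrite !in_itv/= addr0.
- case: ifPn => t2 [At /andP[t0 t1]]; [left|right]; split => //; apply/andP; split; lra.
- case=> -[At /andP[t0 t1]].
    rewrite ifT; last by lra.
    by split => //; apply/andP; split; lra.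
  rewrite ifF; last by apply/negbTE; rewrite -leNgt; lra.
  by split => //; apply/andP; split; lra.
Qed.

End split_uniform.

(** * Two independent uniform numbers out of one *)

Section digits.
Context {R : realType}.
Local Notation P := (@unif01 R).

(** The doubling map reads the binary digits of [t] one by one; those of odd rank
    and those of even rank are gathered into two numbers.  Removing the first digit
    exchanges odd and even ranks, whence the exchange of components. *)
Fixpoint split_digits (m : nat) (t : R) : R * R :=
  if m is m'.+1 then
    if t < 2^-1 then
      let p := split_digits m' (2 * t) in (p.2 / 2, p.1)
    else let p := split_digits m' (2 * t - 1) in ((1 + p.2) / 2, p.1)
  else (0, 0).

Lemma split_digitsS m t : split_digits m.+1 t =
  if t < 2^-1 then ((split_digits m (2 * t)).2 / 2, (split_digits m (2 * t)).1)
  else ((1 + (split_digits m (2 * t - 1)).2) / 2, (split_digits m (2 * t - 1)).1).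
Proof. by []. Qed.

Lemma split_digits_itv m t :
  0 <= (split_digits m t).1 <= 1 /\ 0 <= (split_digits m t).2 <= 1.
Proof.
elim: m t => [|m IH] t /=; first by rewrite lexx ler01.
case: ifPn => _ /=.
  by have [/andP[a b] /andP[c d]] := IH (2 * t); split; apply/andP; split; lra.
by have [/andP[a b] /andP[c d]] := IH (2 * t - 1); split; apply/andP; split; lra.
Qed.

Lemma split_digits_homo m t :
  (split_digits m t).1 <= (split_digits m.+1 t).1 /\
  (split_digits m t).2 <= (split_digits m.+1 t).2.
Proof.
elim: m t => [|m IH] t.
  by have [/andP[a b] /andP[c d]] := split_digits_itv 1 t.
rewrite (split_digitsS m.+1) (split_digitsS m).
case: ifPn => _; [have [] := IH (2 * t)|have [] := IH (2 * t - 1)];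
  move: (split_digits m.+1 _) (split_digits m _) => p q h1 h2 /=; split; lra.
Qed.

Definition odd_digits (t : R) : R := limn (fun m => (split_digits m t).1).
Definition even_digits (t : R) : R := limn (fun m => (split_digits m t).2).

Lemma odd_digits_cvg t : (split_digits m t).1 @[m --> \oo] --> odd_digits t.
Proof.
apply: nondecreasing_is_cvgn.
  by apply/nondecreasing_seqP => m; have [] := split_digits_homo m t.
exists 1 => _ [m _ <-]; have [/andP[_ ? _]] := split_digits_itv m t => //.
Qed.

Lemma even_digits_cvg t : (split_digits m t).2 @[m --> \oo] --> even_digits t.
Proof.
apply: nondecreasing_is_cvgn.
  by apply/nondecreasing_seqP => m; have [] := split_digits_homo m t.
by exists 1 => _ [m _ <-]; have [_ /andP[_ ?]] := split_digits_itv m t.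
Qed.

Lemma odd_digitsE t : odd_digits t =
  if t < 2^-1 then even_digits (2 * t) / 2 else (1 + even_digits (2 * t - 1)) / 2.
Proof.
apply/cvg_lim => //; rewrite -cvg_shiftS/=; case: ifPn => _.
  by apply: cvgMl; exact: even_digits_cvg.
by apply: cvgMl; apply: cvgD; [exact: cvg_cst|exact: even_digits_cvg].
Qed.

Lemma even_digitsE t : even_digits t =
  if t < 2^-1 then odd_digits (2 * t) else odd_digits (2 * t - 1).
Proof.
apply/cvg_lim => //; rewrite -cvg_shiftS/=.
by case: ifPn => _; exact: odd_digits_cvg.
Qed.

Lemma odd_digits_itv t : 0 <= odd_digits t <= 1.
Proof.
apply/andP; split.
  apply: limr_ge; first by apply/cvg_ex; eexists; exact: odd_digits_cvg.
  by apply: nearW => m; have [/andP[]] := split_digits_itv m t.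
apply: limr_le; first by apply/cvg_ex; eexists; exact: odd_digits_cvg.
by apply: nearW => m; have [/andP[]] := split_digits_itv m t.
Qed.

Lemma even_digits_itv t : 0 <= even_digits t <= 1.
Proof. by rewrite even_digitsE; case: ifPn => _; exact: odd_digits_itv. Qed.

Lemma measurable_split_digits m :
  measurable_fun [set: R] (fun t => (split_digits m t).1) /\
  measurable_fun [set: R] (fun t => (split_digits m t).2).
Proof.
elim: m => [|m [IH1 IH2]] //=.
have maff (c : R) : measurable_fun [set: R] (fun t : R => 2 * t + c).
  by apply: measurable_funD => //; exact: measurable_funM.
have m0 : measurable_fun [set: R] (fun t : R => 2 * t) by exact: measurable_funM.
have mlt : measurable_fun [set: R] (fun t : R => t < 2^-1).
  by apply: measurable_fun_ltr.
split.
  rewrite (_ : (fun t => _) = (fun t => if t < 2^-1 then (split_digits m (2 * t)).2 / 2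
    else (1 + (split_digits m (2 * t - 1)).2) / 2)); last first.
    by apply/funext => t; case: ifPn.
  apply: measurable_fun_ifT => //; apply: measurable_funM => //.
    exact: (measurableT_comp IH2 m0).
  by apply: measurable_funD => //; exact: (measurableT_comp IH2 (maff _)).
rewrite (_ : (fun t => _) = (fun t => if t < 2^-1 then (split_digits m (2 * t)).1
    else (split_digits m (2 * t - 1)).1)); last first.
  by apply/funext => t; case: ifPn.
apply: measurable_fun_ifT => //.
  exact: (measurableT_comp IH1 m0).
exact: (measurableT_comp IH1 (maff _)).
Qed.

Lemma measurable_odd_digits : measurable_fun [set: R] odd_digits.
Proof.
apply: (@measurable_fun_cvg _ _ _ _ (fun m t => (split_digits m t).1)).
  by move=> m; have [] := measurable_split_digits m.
by move=> t _; exact: odd_digits_cvg.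
Qed.

Lemma measurable_even_digits : measurable_fun [set: R] even_digits.
Proof.
apply: (@measurable_fun_cvg _ _ _ _ (fun m t => (split_digits m t).2)).
  by move=> m; have [] := measurable_split_digits m.
by move=> t _; exact: even_digits_cvg.
Qed.

Let tailset a b : set R := [set t | a < odd_digits t /\ b < even_digits t].

Let mtailset a b : measurable (tailset a b).
Proof.
rewrite (_ : tailset a b = odd_digits @^-1` `]a, +oo[ `&` even_digits @^-1` `]b, +oo[).
  by apply: measurableI; rewrite -[X in measurable X]setTI;
    [apply: measurable_odd_digits|apply: measurable_even_digits].
by apply/seteqP; split => t /=; rewrite !in_itv/= !andbT.
Qed.

Let G a b : R := fine (P (tailset a b)).
(* the probability that a uniform number exceeds [a] *)
Let c (a : R) : R := if a < 0 then 1 else if a < 1 then 1 - a else 0.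

Let c_half a : c a = (c (2 * a) + c (2 * a - 1)) / 2.
Proof. by rewrite /c; do ![case: ifPn => ?]; lra. Qed.

Let G_half a b : G a b = (G b (2 * a) + G b (2 * a - 1)) / 2.
Proof.
rewrite /G.
have -> : tailset a b = [set t | if t < 2^-1 then tailset b (2 * a) (2 * t)
    else tailset b (2 * a - 1) (2 * t - 1)].
  apply/seteqP; split => t; rewrite /tailset/= (odd_digitsE t) (even_digitsE t);
    by case: ifPn => _ [] *; split; lra.
rewrite unif01_split//.
have fP A : measurable A -> (P A) \is a fin_num by move=> mA; exact: fin_num_measure.
move: (fP _ (mtailset b (2 * a))) (fP _ (mtailset b (2 * a - 1))).
case: (P (tailset b (2 * a))) => // x _; case: (P _) => // y _ /=.
by rewrite -mulrDr mulrC.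
Qed.

(** The defect of independence on quadrants.  Reading one digit gives the equation
    [D_half], in which one of the two terms always vanishes; the other one is
    halved, so that iterating forces [D = 0]. *)
Let D a b := G a b - c a * c b.

Let D_half a b : D a b = (D b (2 * a) + D b (2 * a - 1)) / 2.
Proof. by rewrite /D G_half [c a]c_half; field. Qed.

Let D_neg a a' b : a < 0 -> a' < 0 -> D a b = D a' b.
Proof.
move=> a0 a'0; rewrite /D /c a0 a'0; congr (fine (P _) - _).
apply/(@seteqP R); split => t [] /= _ ?; split => //; have /andP[? ?] := odd_digits_itv t; lra.
Qed.

Let D_ge1 a b : 1 <= a -> D a b = 0.
Proof.
move=> a1; have ca : c a = 0 by rewrite /c; do ![case: ifPn => ?]; lra.
rewrite /D ca.
rewrite /G (_ : tailset a b = set0) ?measure0 ?mul0r ?subr0//.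
by apply/(@seteqP R); split => t //= [] /= ? _; have /andP[? ?] := odd_digits_itv t; lra.
Qed.

Let D_ge1r a b : 1 <= b -> D a b = 0.
Proof. by move=> b1; rewrite D_half D_ge1// D_ge1// addr0 mul0r. Qed.

Let D_NN : D (-1) (-1) = 0.
Proof.
rewrite /D /c ltrN10 /G (_ : tailset _ _ = setT) ?probability_setT/=; first lra.
apply/(@seteqP R); split => t //= _; split; have /andP[? ?] := odd_digits_itv t;
  have /andP[? ?] := even_digits_itv t; lra.
Qed.

Let D_le1 a b : `|D a b| <= 1.
Proof.
have /andP[g0 g1] : 0 <= G a b <= 1.
  apply/andP; split; first exact/fine_ge0/measure_ge0.
  rewrite -lee_fin fineK; last by apply: fin_num_measure; exact: mtailset.
  by apply: probability_le1; exact: mtailset.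
have cc x : 0 <= c x <= 1 by rewrite /c; do ![case: ifPn => ?]; lra.
have /andP[a0 a1] := cc a; have /andP[b0 b1] := cc b.
rewrite ler_norml /D; apply/andP; split; nra.
Qed.

Let D_neg_r a : D a (-1) = D (-1) a.
Proof.
rewrite [RHS]D_half (_ : D a (2 * -1) = D a (-1)).
  by rewrite (_ : D a (2 * -1 - 1) = D a (-1)); [lra|rewrite D_half [RHS]D_half;
    congr ((_ + _) / _); apply: D_neg; lra].
by rewrite D_half [RHS]D_half; congr ((_ + _) / _); apply: D_neg; lra.
Qed.

Let half_le (x : R) k : `|x| <= 2^-1 ^+ k -> `|x / 2| <= 2^-1 ^+ k.+1.
Proof.
by rewrite normrM exprSr (@ger0_norm _ 2^-1) ?invr_ge0// ler_pM2r ?invr_gt0.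
Qed.

(** A negative first argument puts no constraint on the first number, so this is
    the statement that the second number is uniform. *)
Let D_marg a : D (-1) a = 0.
Proof.
have H k : forall a, `|D (-1) a| <= 2^-1 ^+ k.
  elim: k => [|k IH] a'; first exact: D_le1.
  rewrite -D_neg_r D_half; have [a2|a2] := lerP 2^-1 a'.
    by rewrite D_ge1r ?add0r; [exact: half_le|lra].
  have -> : D (-1) (2 * a' - 1) = 0.
    by rewrite -D_neg_r (@D_neg _ (-1)) ?D_NN//; lra.
  by rewrite addr0; exact: half_le.
apply/eqP; rewrite -normr_le0; apply/ler_addgt0Pr => e e0; rewrite add0r.
have : (2^-1 : R) ^+ k @[k --> \oo] --> 0 by apply: cvg_expr; rewrite ger0_norm; lra.
move/cvgr0Pnorm_lt => /(_ _ e0)[k _ /(_ k (leqnn k)) /= hk].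
by rewrite (le_trans (H k a))// (le_trans (ler_norm _))// ltW.
Qed.

Let D_eq0 a b : D a b = 0.
Proof.
have H k : forall a b, `|D a b| <= 2^-1 ^+ k.
  elim: k => [|k IH] a' b'; first exact: D_le1.
  rewrite D_half; have [a2|a2] := lerP 2^-1 a'.
    by rewrite D_ge1r ?add0r; [exact: half_le|lra].
  have -> : D b' (2 * a' - 1) = 0.
    transitivity (D b' (-1)); last by rewrite D_neg_r D_marg.
    by rewrite D_half [RHS]D_half; congr ((_ + _) / _); apply: D_neg; lra.
  by rewrite addr0; exact: half_le.
apply/eqP; rewrite -normr_le0; apply/ler_addgt0Pr => e e0; rewrite add0r.
have : (2^-1 : R) ^+ k @[k --> \oo] --> 0 by apply: cvg_expr; rewrite ger0_norm; lra.
move/cvgr0Pnorm_lt => /(_ _ e0)[k _ /(_ k (leqnn k)) /= hk].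
by rewrite (le_trans (H k a b))// (le_trans (ler_norm _))// ltW.
Qed.

Let P_ray a : P `]a, +oo[%classic = (c a)%:E.
Proof.
rewrite unif01E /c; case: ifPn => a0.
  rewrite (_ : _ `&` _ = `[0, 1]%classic); last first.
    apply/(@seteqP R); split => t /=; rewrite !in_itv/= andbT; first by case.
    by case/andP => t0 t1; split; [lra|apply/andP].
  by rewrite lebesgue_measure_itv/= lte_fin ltr01 oppr0 adde0.
case: ifPn => a1.
  rewrite (_ : _ `&` _ = `]a, 1]%classic); last first.
    apply/(@seteqP R); split => t /=; rewrite !in_itv/= andbT.
      by case=> ? /andP[? ?]; apply/andP.
    by case/andP=> ? ?; split => //; apply/andP; split; lra.
  by rewrite lebesgue_measure_itv/= lte_fin a1.
rewrite (_ : _ `&` _ = set0) ?measure0//.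
by apply/(@seteqP R); split => t //=; rewrite !in_itv/= andbT => -[? /andP[? ?]]; lra.
Qed.

Let P_tail a b : P (tailset a b) = (P `]a, +oo[%classic * P `]b, +oo[%classic)%E.
Proof.
have := D_eq0 a b; rewrite !P_ray /D /G -EFinM => /eqP; rewrite subr_eq0 => /eqP <-.
by rewrite fineK//; apply: fin_num_measure; exact: mtailset.
Qed.

Let mpre1 A : measurable A -> measurable (odd_digits @^-1` A).
Proof. by move=> mA; rewrite -[X in measurable X]setTI; exact: measurable_odd_digits. Qed.

Let mpre2 A : measurable A -> measurable (even_digits @^-1` A).
Proof. by move=> mA; rewrite -[X in measurable X]setTI; exact: measurable_even_digits. Qed.

(** [ray_measure_unique] extends [P_tail] from rays to Borel sets, first in one
    variable and then in the other. *)
Lemma digits_independent A B : measurable A -> measurable B ->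
  P (odd_digits @^-1` A `&` even_digits @^-1` B) = (P A * P B)%E.
Proof.
have mray b : measurable (`]b, +oo[%classic : set R) by exact: measurable_itv.
have md1 : @measurable_fun _ _ (measurableTypeR R) (measurableTypeR R) setT odd_digits.
  exact: measurable_odd_digits.
have md2 : @measurable_fun _ _ (measurableTypeR R) (measurableTypeR R) setT even_digits.
  exact: measurable_even_digits.
have fineP1 A' : measurable A' -> (fine (P A'))%:E = P A'.
  by move=> ?; rewrite fineK//; exact: fin_num_measure.
have cge0 A' : 0 <= fine (P A') by exact/fine_ge0/measure_ge0.
have step1 b A' : measurable A' ->
    P (odd_digits @^-1` A' `&` even_digits @^-1` `]b, +oo[) = (P A' * P `]b, +oo[%classic)%E.
  move=> mA.
  pose m1 := push_measure (mrestr P (mpre2 (mray b))) md1.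
  pose m2 := mscale (NngNum (cge0 `]b, +oo[%classic)) P.
  have m1E X : m1 X = P (odd_digits @^-1` X `&` even_digits @^-1` `]b, +oo[) by [].
  have m2E X : m2 X = (P X * P `]b, +oo[%classic)%E.
    by rewrite muleC -(fineP1 `]b, +oo[%classic).
  rewrite -m1E -m2E.
  apply: ray_measure_unique => //.
    rewrite (_ : m1 setT = P (even_digits @^-1` `]b, +oo[)); last exact: (congr1 P (setTI _)).
    by rewrite (le_lt_trans (probability_le1 _ _)) ?ltry//; exact: mpre2.
  move=> a; apply: etrans (esym (m2E _)); rewrite m1E -P_tail; congr (P _); apply/(@seteqP R).
  by split => t /=; rewrite !in_itv/= !andbT.
move=> mA mB.
pose m1 := push_measure (mrestr P (mpre1 mA)) md2.
pose m2 := mscale (NngNum (cge0 A)) P.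
have m1E X : m1 X = P (odd_digits @^-1` A `&` even_digits @^-1` X).
  by rewrite setIC.
have m2E X : m2 X = (P A * P X)%E by rewrite -(fineP1 A mA).
rewrite -m1E -m2E; apply: ray_measure_unique => //.
  rewrite (_ : m1 setT = P (odd_digits @^-1` A)); last exact: (congr1 P (setTI _)).
  by rewrite (le_lt_trans (probability_le1 _ _)) ?ltry//; exact: mpre1.
by move=> b; apply: etrans (esym (m2E _)); rewrite m1E step1.
Qed.

Lemma ge0_integral_digits (H : R * R -> \bar R) :
  measurable_fun setT H -> (forall z, (0 <= H z)%E) ->
  (\int[P]_t H (odd_digits t, even_digits t) = \int[P]_u \int[P]_v H (u, v))%E.
Proof.
move=> mH H0.
have md : @measurable_fun _ _ (measurableTypeR R) (measurableTypeR R * measurableTypeR R)%type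
    setT (fun t => (odd_digits t, even_digits t)).
  by apply/measurable_fun_pairP; split; [exact: measurable_odd_digits|exact: measurable_even_digits].
have mH' : @measurable_fun _ _ (measurableTypeR R * measurableTypeR R)%type _ setT H by [].
rewrite -(@fubini_tonelli1 _ _ (measurableTypeR R) (measurableTypeR R) R P P H mH' H0).
transitivity (\int[push_measure P md]_z H z)%E.
  by rewrite ge0_integral_pushforward.
apply: eq_measure_integral => A mA _; apply/esym.
apply: product_measure_unique => // A1 A2 mA1 mA2.
by rewrite -digits_independent.
Qed.

End digits.

(** * Quantile functions *)

Section quantile.
Context {R : realType} (nu : probability (measurableTypeR R) R).
Local Notation P := (@unif01 R).
Local Notation mu := (@lebesgue_measure R).

Lemma unif01_oo (A : set R) : measurable A -> P A = mu (A `&` `]0, 1[).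
Proof.
move=> mA; rewrite unif01E.
have m01 : measurable ([set 0; 1] : set R) by exact: measurableU.
have -> : A `&` `[0, 1] = (A `&` `]0, 1[) `|` (A `&` [set 0; 1]).
  rewrite -setIUr; congr (_ `&` _); apply/(@seteqP R); split => t /=; rewrite !in_itv/=.
    case/andP; rewrite le_eqVlt => /orP[/eqP <- _|t0]; first by right; left.
    rewrite le_eqVlt => /orP[/eqP ->|t1]; first by right; right.
    by left; rewrite t0.
  by case=> [/andP[/ltW -> /ltW ->]//|[->|->]]; rewrite ler01 lexx.
apply: measureU0; [exact: measurableI|exact: measurableI|].
apply/eqP; rewrite eq_le measure_ge0 andbT.
apply: (@le_trans _ _ (mu [set 0; 1])); first by rewrite le_measure ?inE//; exact: measurableI.
rewrite measureU0//; last exact: lebesgue_measure_set1.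
by rewrite -[X in (_ <= X)%E](lebesgue_measure_set1 (0 : R)); exact: lexx.
Qed.

Let X0 : measurableTypeR R -> R := idfun.
Let mX0 : measurable_fun [set: measurableTypeR R] X0.
Proof. exact: measurable_id. Qed.
Let X : {RV nu >-> R} := HB.pack X0 (isMeasurableFun.Build _ _ _ _ _ mX0).

Let F (t : R) : R := fine (cdf X t).

Let FE t : cdf X t = (F t)%:E.
Proof. by rewrite /F fineK//; apply: fin_num_measure. Qed.

Let F_homo : {homo F : x y / x <= y}.
Proof. by move=> x y xy; rewrite -lee_fin -!FE; exact: cdf_nondecreasing. Qed.

(** The generalised inverse of the distribution function [F]; outside the open
    interval the set may be empty or unbounded. *)
Definition quantile (u : R) : R :=
  if (0 < u) && (u < 1) then sup [set t | F t < u] else 0.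

(** The Galois connection between [F] and its inverse; its strict form relies on
    the right continuity of [F]. *)
Let quantileP u a : 0 < u -> u < 1 -> (a < quantile u) = (F a < u).
Proof.
move=> u0 u1; rewrite /quantile u0 u1 /=.
have [t0 Ft0] : exists t, F t < u.
  have : F @ -oo --> (0 : R).
    have := @cvg_cdfNy0 _ _ _ nu X; rewrite (_ : cdf X = EFin \o F); last exact/funext.
    by move/fine_cvgP => [].
  move=> /cvgrPdist_lt/(_ u u0) [M [_ HM]].
  exists (M - 1); have := HM (M - 1); rewrite sub0r normrN.
  by move=> /(_ ltac:(lra)); exact: le_lt_trans (ler_norm _).
have [t1 Ft1] : exists t, u < F t.
  have : F @ +oo --> (1 : R).
    have := @cvg_cdfy1 _ _ _ nu X; rewrite (_ : cdf X = EFin \o F); last exact/funext.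
    by move/fine_cvgP => [].
  have u1' : 0 < 1 - u by lra.
  move=> /cvgrPdist_lt/(_ _ u1') [M [_ HM]].
  exists (M + 1); have := HM (M + 1) ltac:(lra).
  by have := ler_norm (1 - F (M + 1)); lra.
have hs : has_sup [set t | F t < u].
  split; first by exists t0.
  exists t1 => t /= Ft; rewrite leNgt; apply/negP => /ltW/F_homo; lra.
apply/idP/idP.
  move=> /(sup_gt (ex_intro _ t0 Ft0))-[t /= Ft /ltW/F_homo]; lra.
move=> Fa.
have : F x @[x --> a^'+] --> F a.
  have := @cdf_right_continuous _ _ _ nu X a; rewrite (_ : cdf X = EFin \o F); last exact/funext.
  by move/fine_cvgP => [].
have ua : 0 < u - F a by lra.
move=> /cvgrPdist_lt/(_ _ ua) [e /= e0 He].
have := He (a + e / 2); rewrite /ball_/= opprD addNKr normrN gtr0_norm; last lra.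
move=> /(_ ltac:(lra) ltac:(lra)) Fae.
apply: (@lt_le_trans _ _ (a + e / 2)); first lra.
apply: ub_le_sup; first by case: hs.
by move=> /=; have := ler_norm (F (a + e / 2) - F a); rewrite distrC; lra.
Qed.

Lemma measurable_quantile : measurable_fun [set: R] quantile.
Proof.
have m01 : measurable (`]0, 1[%classic : set R) by exact: measurable_itv.
apply: (measurability _ (RGenOInfty.measurableE R)) => //= _ [_ [a ->] <-].
rewrite setTI (_ : _ @^-1` _ = (`]0, 1[ `&` `]F a, +oo[) `|`
   (~` `]0, 1[ `&` [set _ | a < 0])); last first.
  apply/(@seteqP R); split => u /=; rewrite !in_itv/= !andbT.
    case: (boolP ((0 < u) && (u < 1))) => [/andP[u0 u1]|u01].
      by rewrite quantileP// => ?; left.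
    by rewrite /quantile (negbTE u01) => ?; right.
  case=> [[/andP[u0 u1]]|[/negP u01]]; first by rewrite quantileP.
  by rewrite /quantile (negbTE u01).
apply: measurableU; first by apply: measurableI => //; exact: measurable_itv.
apply: measurableI; first exact: measurableC.
have [a0|a0] := boolP (a < 0).
  by rewrite (_ : [set _ | _] = setT)//; apply/seteqP.
by rewrite (_ : [set _ | _] = set0)//; apply/seteqP; split.
Qed.

Lemma quantile_law A : measurable A -> P (quantile @^-1` A) = nu A.
Proof.
move=> mA.
have mQ : @measurable_fun _ _ (measurableTypeR R) (measurableTypeR R) setT quantile.
  exact: measurable_quantile.
suff : push_measure P mQ A = nu A by [].
apply: ray_measure_unique => //.
  rewrite (_ : push_measure P mQ setT = P setT)//.
  by rewrite probability_setT ltry.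
move=> a; transitivity (P (quantile @^-1` `]a, +oo[)) => //.
have mray : measurable (`]a, +oo[%classic : set R) by exact: measurable_itv.
rewrite unif01_oo; last by rewrite -[X in measurable X]setTI; exact: mQ.
rewrite (_ : _ `&` _ = `]F a, 1[%classic); last first.
  apply/(@seteqP R); split => u /=; rewrite !in_itv/= !andbT.
    by case=> + /andP[u0 u1]; rewrite quantileP// => ->.
  have F0 : 0 <= F a by exact/fine_ge0/measure_ge0.
  case/andP => Fu u1; have u0 : 0 < u by exact: le_lt_trans Fu.
  by rewrite quantileP// u0 u1.
apply: (@etrans _ _ (1 - (F a)%:E)%E); last first.
  have mNa : measurable (`]-oo, a]%classic : set R) by exact: measurable_itv.
  by have := @probability_setC _ _ _ nu _ mNa; rewrite setCitvl -FE => h; exact: (esym h).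
rewrite lebesgue_measure_itv/= lte_fin; case: ifPn => //.
have : F a <= 1 by rewrite -lee_fin -FE; exact: cdf_le1.
rewrite -leNgt => h1 h2; have -> : F a = 1 by apply/eqP; rewrite eq_le h1.
by rewrite subee.
Qed.

End quantile.

(** * Rotations of the Gaussian plane *)

Section plane.
Context {R : realType}.
Local Notation mu := (@lebesgue_measure R).
Local Notation pdf := (@normal_pdf R 0 1).
Local Open Scope ereal_scope.

Definition gauss : probability (measurableTypeR R) R := normal_prob 0 1.

Lemma ge0_integral_gauss (f : R -> \bar R) :
  measurable_fun setT f -> (forall x, 0 <= f x) ->
  \int[gauss]_x f x = \int[mu]_x (f x * (pdf x)%:E).
Proof.
move=> mf f0.
have dom : gauss `<< mu by exact: normal_prob_dominates.
rewrite -(@Radon_Nikodym_SigmaFinite.change_of_variables _ _ _ gauss mu dom f setT)//.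
have mpdf : measurable_fun [set: measurableTypeR R] (fun x => (pdf x)%:E).
  by apply/measurable_EFinP; exact: measurable_normal_pdf.
apply: ae_eq_integral => //.
- apply: emeasurable_funM => //; apply: (measurable_int mu).
  exact: Radon_Nikodym_SigmaFinite.f_integrable.
- exact: emeasurable_funM.
- apply: ae_eqe_mul2l.
  apply: integral_ae_eq => //.
    exact: Radon_Nikodym_SigmaFinite.f_integrable.
  by move=> E _ mE; rewrite -Radon_Nikodym_SigmaFinite.f_integral.
Qed.

Lemma ge0_integral_translate (f : R -> \bar R) (c : R) :
  measurable_fun setT f -> (forall x, 0 <= f x) ->
  \int[mu]_x f (x + c)%R = \int[mu]_x f x.
Proof.
move=> mf f0.
have mt : @measurable_fun _ _ (measurableTypeR R) (measurableTypeR R) setT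
    (fun x : R => x + c)%R.
  suff : measurable_fun [set: R] (fun t : R => t + c)%R by [].
  exact: measurable_funD.
transitivity (\int[push_measure mu mt]_x f x).
  by rewrite ge0_integral_pushforward.
apply: eq_measure_integral => A mA _.
transitivity (mu ((fun t => 1 * t + c)%R @^-1` A)).
  by congr (mu _); apply/seteqP; split => t /=; rewrite mul1r.
by have := lebesgue_measure_affine c (@ltr01 R) mA; rewrite invr1 mul1e => h; exact: h.
Qed.

Let I (H : R * R -> \bar R) := \int[mu]_x \int[mu]_y H (x, y).

Let measurable_affine2 (a b : R) : measurable_fun [set: R * R] (fun z => a * z.1 + b * z.2)%R.
Proof. by apply: measurable_funD; apply: measurable_funM. Qed.

Lemma measurable_linear2 (a b c d : R) :
  measurable_fun [set: R * R] (fun z => (a * z.1 + b * z.2, c * z.1 + d * z.2)%R).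
Proof. by apply/measurable_fun_pairP; split; exact: measurable_affine2. Qed.

Let measurable_shear1 (a : R) :
  measurable_fun [set: R * R] (fun z => (z.1 + a * z.2, z.2)%R).
Proof.
have := measurable_linear2 1 a 0 1; congr (measurable_fun _ _).
by apply/funext => z; congr (_, _); ring.
Qed.

Let measurable_shear2 (a : R) :
  measurable_fun [set: R * R] (fun z => (z.1, z.2 + a * z.1)%R).
Proof.
have := measurable_linear2 1 0 a 1; congr (measurable_fun _ _).
by apply/funext => z; congr (_, _); ring.
Qed.

Let shear1 a H : measurable_fun setT H -> (forall z, 0 <= H z) ->
  I (fun z => H (z.1 + a * z.2, z.2)%R) = I H.
Proof.
move=> mH H0; rewrite /I.
have mH' : measurable_fun setT (fun z : R * R => H (z.1 + a * z.2, z.2)%R).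
  exact: measurableT_comp mH (measurable_shear1 a).
have swap := @fubini_tonelli _ _ (measurableTypeR R) (measurableTypeR R) R mu mu.
apply: (etrans (swap _ mH' _)); first by move=> z; exact: H0.
apply: (etrans _ (esym (swap _ mH H0))).
apply: eq_integral => y _.
have mHy : measurable_fun [set: R] (fun x => H (x, y)).
  exact: measurableT_comp mH (pair2_measurable y).
exact: (ge0_integral_translate (a * y) mHy).
Qed.

Let shear2 a H : measurable_fun setT H -> (forall z, 0 <= H z) ->
  I (fun z => H (z.1, z.2 + a * z.1)%R) = I H.
Proof.
move=> mH H0; apply: eq_integral => x _ /=.
have mHx : measurable_fun [set: R] (fun y => H (x, y)).
  exact: measurableT_comp mH (pair1_measurable x).
exact: (ge0_integral_translate (a * x) mHx).
Qed.

(** A rotation is a product of three shears, and a shear is a translation on each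
    line of one of the two axis directions. *)
Let rotation a b H : (a ^+ 2 + b ^+ 2 = 1)%R ->
  measurable_fun setT H -> (forall z, 0 <= H z) ->
  I (fun z => H (a * z.1 - b * z.2, b * z.1 + a * z.2)%R) = I H.
Proof.
move=> + mH H0.
have base a' b' (H' : R * R -> \bar R) : (a' ^+ 2 + b' ^+ 2 = 1)%R -> (1 + a' != 0)%R ->
    measurable_fun setT H' -> (forall z, 0 <= H' z) ->
    I (fun z => H' (a' * z.1 - b' * z.2, b' * z.1 + a' * z.2)%R) = I H'.
  (* the slopes are [- t], [b'] and [- t], where [t] is the tangent of half the
     angle *)
  move=> ab a1 mH' H'0; pose t := (b' / (1 + a'))%R.
  pose H1 z := H' (z.1 + - t * z.2, z.2)%R.
  pose H2 z := H1 (z.1, z.2 + b' * z.1)%R.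
  have mH1 : measurable_fun setT H1.
    exact: measurableT_comp mH' (measurable_shear1 (- t)).
  have mH2 : measurable_fun setT H2.
    exact: measurableT_comp mH1 (measurable_shear2 b').
  apply: (etrans _ (shear1 (- t) mH' H'0)).
  apply: (etrans _ (shear2 b' mH1 (fun z => H'0 _))).
  apply: (etrans _ (shear1 (- t) mH2 (fun z => H'0 _))).
  have tE : (t * (1 + a') = b')%R by rewrite mulfVK.
  have tb : (t * b' = 1 - a')%R.
    by apply: (mulIf a1); rewrite mulrAC tE; lra.
  apply: eq_integral => x _; apply: eq_integral => y _.
  have h1 : (t * b' * x = (1 - a') * x)%R by rewrite tb.
  have h2 : (t * t * b' * y = t * (1 - a') * y)%R by rewrite -(mulrA t) tb.
  have h3 : (t * (1 + a') * y = b' * y)%R by rewrite tE.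
  have h4 : (t * b' * y = (1 - a') * y)%R by rewrite tb.
  rewrite /H2 /H1; congr (H' (_, _)); move: h1 h2 h3 h4 => /=; clear; move: (x : R) (y : R) => {}x {}y; lra.
have [->|a1] := eqVneq a (-1)%R; last by move=> ab; apply: base; rewrite // -[1%R]opprK addrC subr_eq0.
(* the half turn has no such [t], but it is the square of the quarter turn *)
move=> b0; have {b0}-> : b = 0%R by apply/eqP; rewrite -sqrf_eq0; apply/eqP; lra.
pose H1 z := H (0 * z.1 - 1 * z.2, 1 * z.1 + 0 * z.2)%R.
have mH1 : measurable_fun setT H1.
  apply: measurableT_comp => //.
  by have := @measurable_linear2 0 (-1) 1 0; under eq_fun do rewrite mulNr.
have e01 : ((0 : R) ^+ 2 + 1 ^+ 2 = 1)%R by ring.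
have n1 : (1 + (0 : R) != 0)%R by rewrite addr0 oner_eq0.
apply: (etrans _ (base _ _ H e01 n1 mH H0)).
apply: (etrans _ (base _ _ H1 e01 n1 mH1 (fun z => H0 _))).
by apply: eq_integral => x _; apply: eq_integral => y _; congr (H (_, _)) => /=; ring.
Qed.

Let pdfE (x : R) : pdf x = (normal_peak 1 * expR (- (x ^+ 2) / 2))%R.
Proof. by rewrite normal_pdfE ?oner_neq0// /normal_fun subr0 expr1n. Qed.

Let I_gauss H : measurable_fun setT H -> (forall z, 0 <= H z) ->
  \int[gauss]_x \int[gauss]_y H (x, y) = I (fun z => H z * (pdf z.1 * pdf z.2)%:E).
Proof.
move=> mH H0.
have mpdf : measurable_fun [set: R] (fun x => (pdf x)%:E).
  by apply/measurable_EFinP; exact: measurable_normal_pdf.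
rewrite ge0_integral_gauss; first last.
- by move=> x; exact: integral_ge0.
- exact: (@measurable_fun_fubini_tonelli_F _ _ (measurableTypeR R) (measurableTypeR R) R gauss H mH).
apply: eq_integral => x _.
have mHx : measurable_fun [set: R] (fun y => H (x, y)) by exact: measurableT_comp.
rewrite ge0_integral_gauss// -ge0_integralZr//.
- by apply: eq_integral => y _ /=; rewrite -muleA -EFinM (mulrC (pdf y)).
- exact: emeasurable_funM.
- by move=> y _; rewrite mule_ge0// lee_fin normal_pdf_ge0.
- by rewrite lee_fin normal_pdf_ge0.
Qed.

(** The Gaussian density of the plane depends on the distance to the origin only. *)
Lemma gauss_rotation a b H : (a ^+ 2 + b ^+ 2 = 1)%R ->
  measurable_fun setT H -> (forall z, 0 <= H z) ->
  \int[gauss]_x \int[gauss]_y H (a * x - b * y, b * x + a * y)%R =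
  \int[gauss]_x \int[gauss]_y H (x, y).
Proof.
move=> ab mH H0.
have mrot : measurable_fun [set: R * R] (fun z : R * R =>
    (a * z.1 - b * z.2, b * z.1 + a * z.2)%R).
  by have := @measurable_linear2 a (- b) b a; under eq_fun do rewrite mulNr.
have mHr := measurableT_comp mH mrot.
apply: (etrans (I_gauss mHr (fun z => H0 _))).
apply: (etrans _ (esym (I_gauss mH H0))).
pose W (z : R * R) := H z * (pdf z.1 * pdf z.2)%:E.
have mW : measurable_fun setT W.
  apply: emeasurable_funM => //; apply/measurable_EFinP; apply: measurable_funM.
    exact: measurableT_comp (measurable_normal_pdf _ _) measurable_fst.
  exact: measurableT_comp (measurable_normal_pdf _ _) measurable_snd.
have W0 z : 0 <= W z.
  by apply: mule_ge0; [exact: H0|rewrite lee_fin mulr_ge0 ?normal_pdf_ge0].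
apply: (etrans _ (rotation ab mW W0)); rewrite /W.
apply: eq_integral => x _; apply: eq_integral => y _ /=; congr (_ * _%:E).
rewrite !pdfE !mulrA ![(_ * expR _ * normal_peak 1)%R]mulrAC -!mulrA -!expRD.
congr (_ * (_ * expR _))%R.
have h1 : ((a ^+ 2 + b ^+ 2) * (x : R) ^+ 2 = (x : R) ^+ 2)%R by rewrite ab mul1r.
have h2 : ((a ^+ 2 + b ^+ 2) * (y : R) ^+ 2 = (y : R) ^+ 2)%R by rewrite ab mul1r.
by move: h1 h2; move: (x : R) (y : R) => {}x {}y; lra.
Qed.

End plane.

(** * Gaussian vectors on the unit interval *)

Section vector.
Context {R : realType}.
Local Notation P := (@unif01 R).
Local Notation gauss := (@gauss R).

Lemma polar_coordinates (p q : R) :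
  exists r a b, [/\ a ^+ 2 + b ^+ 2 = 1, p = r * a & q = r * b].
Proof.
pose r := Num.sqrt (p ^+ 2 + q ^+ 2).
have r2 : r ^+ 2 = p ^+ 2 + q ^+ 2 by rewrite sqr_sqrtr// addr_ge0 ?sqr_ge0.
have [r0|r0] := eqVneq r 0.
  exists 0, 1, 0; split; first by rewrite expr1n expr0n addr0.
    apply/eqP; rewrite mul0r -sqrf_eq0 eq_le sqr_ge0 andbT.
    by rewrite -[leRHS](expr0n R 2) -r0 r2 lerDl sqr_ge0.
  apply/eqP; rewrite mul0r -sqrf_eq0 eq_le sqr_ge0 andbT.
  by rewrite -[leRHS](expr0n R 2) -r0 r2 lerDr sqr_ge0.
exists r, (p / r), (q / r); split; [|by rewrite mulrC divfK..].
by rewrite !expr_div_n -mulrDl -r2 divff// expf_neq0.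
Qed.

Lemma ge0_integral_quantile (K : R -> \bar R) :
  measurable_fun setT K -> (forall x, (0 <= K x)%E) ->
  (\int[P]_v K (quantile gauss v) = \int[gauss]_z K z)%E.
Proof.
move=> mK K0.
have mQ : @measurable_fun _ _ (measurableTypeR R) (measurableTypeR R) setT (quantile gauss).
  exact: measurable_quantile.
transitivity (\int[push_measure P mQ]_z K z)%E.
  by rewrite ge0_integral_pushforward.
by apply: eq_measure_integral => A mA _; exact: quantile_law.
Qed.

Lemma probability_integral_cst d (U : measurableType d) (m : probability U R)
  (k : \bar R) : (\int[m]_u k = k)%E.
Proof.
rewrite integral_cst//; apply: (etrans (congr1 (mule k) (probability_setT m))).
exact: mule1.
Qed.

(** Two linear forms [<x, g>] and [<y, g>] of a standard Gaussian vector are jointly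
    distributed as [a s] and [c s + e w], where [s] and [w] are independent standard
    Gaussian variables and [a], [c], [e] are the Cholesky factor of the Gram matrix
    of [x] and [y].  As a definition this keeps the dimension out of every later
    computation. *)
Definition gaussian_vector n (g : 'I_n -> R -> R) : Prop :=
  (forall i, measurable_fun setT (g i)) /\
  forall x y : 'I_n -> R, exists a c e : R,
  [/\ a ^+ 2 = \sum_i x i ^+ 2, a * c = \sum_i x i * y i,
      c ^+ 2 + e ^+ 2 = \sum_i y i ^+ 2
    & forall F : R * R -> \bar R, measurable_fun setT F -> (forall z, (0 <= F z)%E) ->
      (\int[P]_t F (\sum_i x i * g i t, \sum_i y i * g i t)%R =
       \int[gauss]_s \int[gauss]_w F (a * s, c * s + e * w)%R)%E].

(** One coordinate is added at a time: [t] yields two independent uniform numbers,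
    the first of which carries the old vector, while the second becomes the new
    coordinate through the quantile function.  Any two linear forms then involve
    three independent Gaussian variables, and two rotations of the plane restore
    the triangular shape. *)
Lemma gaussian_vector_exists n : exists g : 'I_n -> R -> R, gaussian_vector g.
Proof.
elim: n => [|n [g [mg IH]]].
  exists (fun _ _ => 0); split => [i|x y]; first exact: measurable_cst.
  exists 0, 0, 0; rewrite !big_ord0 !mul0r expr0n addr0; split => // F mF F0.
  transitivity (F (0, 0)).
    apply: (etrans _ (probability_integral_cst P _)).
    by apply: eq_integral => t _.
  apply: (etrans (esym (probability_integral_cst gauss _))).
  apply: eq_integral => s _; apply: (etrans (esym (probability_integral_cst gauss _))).
  by apply: eq_integral => w _; rewrite !mul0r addr0.
pose Q := quantile gauss.
pose g' (i : 'I_n.+1) t :=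
  if unlift ord0 i is Some j then g j (odd_digits t) else Q (even_digits t).
have mQ : measurable_fun setT Q by exact: measurable_quantile.
exists g'; split => [i|x y].
  rewrite /g'; case: unliftP => [j _|_].
    exact: measurableT_comp (mg j) measurable_odd_digits.
  exact: measurableT_comp mQ measurable_even_digits.
pose x0 := x ord0; pose y0 := y ord0.
pose x' j := x (lift ord0 j); pose y' j := y (lift ord0 j).
have [a [c [e [a2 ac ce law]]]] := IH x' y'.
have [r [al [be [albe x0E aE]]]] := polar_coordinates x0 a.
pose C := y0 * al + c * be; pose D := c * al - y0 * be.
have [E [al2 [be2 [albe2 DE eE]]]] := polar_coordinates D e.
have sumg z t : \sum_i z i * g' i t =
    z ord0 * Q (even_digits t) + \sum_j z (lift ord0 j) * g j (odd_digits t).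
  rewrite big_ord_recl /g' unlift_none; congr (_ + _).
  by apply: eq_bigr => j _; rewrite liftK.
have D2 : D ^+ 2 + e ^+ 2 = E ^+ 2.
  by rewrite DE eE -[RHS]mulr1 -albe2; ring.
have r2 : r ^+ 2 = x0 ^+ 2 + a ^+ 2.
  by rewrite x0E aE -[LHS]mulr1 -albe; ring.
have rot1 (s z : R) : x0 * (al * s - be * z) + a * (be * s + al * z) = r * s.
  by rewrite x0E aE -[RHS]mul1r -albe; ring.
have rot2 (s z w : R) : y0 * (al * s - be * z) + c * (be * s + al * z) + e * w =
    C * s + (D * z + e * w).
  by rewrite /C /D; ring.
have rot3 (z w : R) : D * (al2 * z - be2 * w) + e * (be2 * z + al2 * w) = E * z.
  by rewrite DE eE -[RHS]mul1r -albe2; ring.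
exists r, C, E; split.
- by rewrite big_ord_recl r2 a2.
- by rewrite big_ord_recl -ac /C -/x0 -/y0 x0E aE; ring.
- have h : C ^+ 2 + D ^+ 2 = (y0 ^+ 2 + c ^+ 2) * (al ^+ 2 + be ^+ 2).
    by rewrite /C /D; ring.
  by rewrite big_ord_recl -ce -D2 addrA h albe mulr1 addrA.
move=> F mF F0.
pose Sx u := \sum_j x' j * g j u; pose Sy u := \sum_j y' j * g j u.
have mS z : measurable_fun setT (fun u => \sum_j z j * g j u).
  by apply: measurable_sum => j; apply: measurable_funM.
pose H (uv : R * R) := F (x0 * Q uv.2 + Sx uv.1, y0 * Q uv.2 + Sy uv.1).
have mH : measurable_fun setT H.
  apply: measurableT_comp => //; apply/measurable_fun_pairP; split => /=.
    apply: measurable_funD; last exact: measurableT_comp (mS x') measurable_fst.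
    by apply: measurable_funM => //; exact: measurableT_comp mQ measurable_snd.
  apply: measurable_funD; last exact: measurableT_comp (mS y') measurable_fst.
  by apply: measurable_funM => //; exact: measurableT_comp mQ measurable_snd.
have H0 z : (0 <= H z)%E by exact: F0.
transitivity (\int[P]_t H (odd_digits t, even_digits t))%E.
  by apply: eq_integral => t _; rewrite /H !sumg.
apply: (etrans (ge0_integral_digits mH H0)).
apply: (etrans (@fubini_tonelli _ _ (measurableTypeR R) (measurableTypeR R) R P P H mH H0)).
(* the old vector contributes two Gaussian variables [s] and [w], the new coordinate
   [z] is the third one; a first rotation of [(z, s)] puts the form of [x] on one
   axis, a second one, of the two other variables, does it for the form of [y] *)
pose F3 (z : (R * R) * R) := F (x0 * z.1.1 + a * z.1.2, y0 * z.1.1 + c * z.1.2 + e * z.2).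
have mF3 : measurable_fun setT F3.
  have m1 : measurable_fun [set: (R * R) * R] (fun z => z.1.1).
    exact: measurableT_comp measurable_fst measurable_fst.
  have m2 : measurable_fun [set: (R * R) * R] (fun z => z.1.2).
    exact: measurableT_comp measurable_snd measurable_fst.
  apply: measurableT_comp => //; apply/measurable_fun_pairP; split => /=.
    by apply: measurable_funD; apply: measurable_funM.
  by apply: measurable_funD; [apply: measurable_funD|]; apply: measurable_funM.
pose H3 (z : R * R) := (\int[gauss]_w F3 (z, w))%E.
have mH3 : measurable_fun setT H3.
  have h := @measurable_fun_fubini_tonelli_F _ _ (measurableTypeR R * measurableTypeR R)%type
    (measurableTypeR R) R gauss F3 mF3.
  by apply: h => z; exact: F0.
have H30 z : (0 <= H3 z)%E by apply: integral_ge0 => w _; exact: F0.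
pose K z := (\int[gauss]_s H3 (z, s))%E.
have mK : measurable_fun setT K.
  exact: (@measurable_fun_fubini_tonelli_F _ _ (measurableTypeR R) (measurableTypeR R) R gauss H3 mH3).
transitivity (\int[P]_v K (Q v))%E.
  apply: eq_integral => v _.
  pose Fv (z : R * R) := F (x0 * Q v + z.1, y0 * Q v + z.2).
  have mFv : measurable_fun setT Fv.
    apply: measurableT_comp => //; apply/measurable_fun_pairP; split => /=;
    by apply: measurable_funD.
  apply: (etrans (law Fv mFv (fun z => F0 _))).
  apply: eq_integral => s _; apply: eq_integral => w _.
  by rewrite /Fv /F3 /= addrA.
apply: (etrans (ge0_integral_quantile mK _)).
  by move=> z; apply: integral_ge0 => s _; exact: H30.
apply: (etrans (esym (gauss_rotation albe mH3 H30))).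
apply: eq_integral => s _.
pose G (z : R * R) := F (r * s, C * s + (D * z.1 + e * z.2)).
have mG : measurable_fun setT G.
  apply: measurableT_comp => //; apply/measurable_fun_pairP; split.
    exact: measurable_cst.
  apply: measurable_funD; first exact: measurable_cst.
  by apply: measurable_funD; apply: measurable_funM.
transitivity (\int[gauss]_y \int[gauss]_w G (y, w))%E.
  apply: eq_integral => y1 _; apply: eq_integral => w _.
  by rewrite /F3 /G /= rot1 rot2.
apply: (etrans (esym (gauss_rotation albe2 mG (fun z => F0 _)))).
apply: eq_integral => y1 _.
transitivity (\int[gauss]_w F (r * s, C * s + E * y1)%R)%E.
  by apply: eq_integral => w _; rewrite /G /= rot3.
exact: probability_integral_cst.
Qed.

End vector.

(** * Moments of the Gaussian law *)

Section moments.
Context {R : realType}.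
Local Notation mu := (@lebesgue_measure R).
Local Notation gauss := (@gauss R).
Local Notation pdf := (@normal_pdf R 0 1).

Lemma ge0_integral_scale (f : R -> \bar R) (k : R) : 0 < k ->
  measurable_fun setT f -> (forall x, (0 <= f x)%E) ->
  (\int[mu]_x f (k * x)%R = k^-1%:E * \int[mu]_x f x)%E.
Proof.
move=> k0 mf f0.
have mt : @measurable_fun _ _ (measurableTypeR R) (measurableTypeR R) setT
    (fun x : R => k * x).
  suff : measurable_fun [set: R] (fun t : R => k * t) by [].
  exact: measurable_funM.
have k0' : 0 <= k^-1 by rewrite invr_ge0 ltW.
transitivity (\int[push_measure mu mt]_x f x)%E.
  by rewrite ge0_integral_pushforward.
transitivity (\int[mscale (NngNum k0') mu]_x f x)%E; last first.
  by rewrite ge0_integral_mscale.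
apply: eq_measure_integral => A mA _.
transitivity (mu ((fun t => k * t + 0) @^-1` A)).
  by congr (mu _); apply/seteqP; split => t /=; rewrite addr0.
exact: lebesgue_measure_affine.
Qed.

Let J (q : R) := (\int[gauss]_s (`|s| `^ q)%:E)%E.

Let mJ q : measurable_fun [set: R] (fun s : R => `|s| `^ q).
Proof.
exact: measurableT_comp (measurable_powR q) (@normr_measurable R setT).
Qed.

Let mpdf : measurable_fun [set: R] pdf.
Proof. exact: measurable_normal_pdf. Qed.

Let JE q : J q = (\int[mu]_s (`|s| `^ q * pdf s)%:E)%E.
Proof.
by rewrite /J ge0_integral_gauss//; apply/measurable_EFinP; exact: mJ.
Qed.

Let mJpdf0 q : measurable_fun [set: R] (fun s : R => (`|s| `^ q * pdf s)%:E).
Proof. by apply/measurable_EFinP; apply: measurable_funM. Qed.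

Let J_scale q k : 0 < k ->
  (\int[mu]_s (`|s| `^ q * pdf (k * s))%:E = (k `^ (- (q + 1)))%:E * J q)%E.
Proof.
move=> k0.
have m1 : measurable_fun [set: R] (fun s : R => (`|s| `^ q * pdf s)%:E).
  by apply/measurable_EFinP; apply: measurable_funM.
have n1 (x : R) : (0 <= (`|x| `^ q * pdf x)%:E)%E.
  by rewrite lee_fin mulr_ge0 ?powR_ge0 ?normal_pdf_ge0.
have e1 : k `^ (- (q + 1)) = k `^ (- q) * k^-1.
  rewrite !powRN powRD; last by rewrite (gt_eqF k0) implybT.
  by rewrite powRr1 ?ltW// invfM.
rewrite JE e1 EFinM -muleA -(ge0_integral_scale k0 m1)// -ge0_integralZl//.
- apply: eq_integral => s _; rewrite -EFinM; congr EFin.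
  rewrite normrM (gtr0_norm k0) powRM ?(ltW k0)// !mulrA powRN mulVf ?mul1r//.
  by rewrite gt_eqF// powR_gt0.
- have mk : measurable_fun [set: R] (fun s : R => k * s) by exact: measurable_funM.
  exact: measurableT_comp m1 mk.
- by rewrite lee_fin powR_ge0.
Qed.

Let pdfE (x : R) : pdf x = normal_peak 1 * expR (- (x ^+ 2) / 2).
Proof. by rewrite normal_pdfE ?oner_neq0// /normal_fun subr0 expr1n. Qed.

Let peak_ge0 : 0 <= @normal_peak R 1.
Proof. exact: normal_peak_ge0. Qed.

(** Dilating the argument of the density divides it by [expR a] with
    [a = (k^2 - 1) x^2 / 2], and [1 + z <= expR z] is used at [z = a] and at
    [z = - a].  The two bounds compare the moments of orders [q] and [q + 2] up to
    second order in [k - 1]. *)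
Let pdf_lower (k x : R) :
  pdf (k * x) + (k ^+ 2 - 1) / 2 * (x ^+ 2 * pdf (k * x)) <= pdf x.
Proof.
rewrite !pdfE; have := expR_ge1Dx ((k ^+ 2 - 1) / 2 * x ^+ 2).
set a := (X in expR X) => a1.
have -> : - x ^+ 2 / 2 = - (k * x) ^+ 2 / 2 + a by rewrite /a; lra.
rewrite expRD; set E := expR (- _ / 2); have E0 : 0 <= E by exact: expR_ge0.
have := ler_wpM2l (mulr_ge0 peak_ge0 E0) a1; rewrite /a; lra.
Qed.

Let pdf_upper (k x : R) :
  pdf x <= pdf (k * x) + (k ^+ 2 - 1) / 2 * (x ^+ 2 * pdf x).
Proof.
rewrite !pdfE; have := expR_ge1Dx (- ((k ^+ 2 - 1) / 2 * x ^+ 2)).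
set a := (X in expR X) => a1.
have -> : - (k * x) ^+ 2 / 2 = - x ^+ 2 / 2 + a by rewrite /a; lra.
rewrite expRD; set E := expR (- _ / 2); have E0 : 0 <= E by exact: expR_ge0.
have := ler_wpM2l (mulr_ge0 peak_ge0 E0) a1; rewrite /a; lra.
Qed.

Let powR2 (q x : R) : 0 <= q -> `|x| `^ (q + 2) = `|x| `^ q * x ^+ 2.
Proof.
move=> q0; rewrite powRD; last by rewrite gt_eqF// ltr_wpDl.
by rewrite powR_mulrn// real_normK// num_real.
Qed.

Let mJpdf q k : measurable_fun [set: R] (fun s : R => (`|s| `^ q * pdf (k * s))%:E).
Proof.
apply/measurable_EFinP; apply: measurable_funM => //.
by apply: (measurableT_comp mpdf); exact: measurable_funM.
Qed.

Let Jpdf_ge0 q (k s : R) : (0 <= (`|s| `^ q * pdf (k * s))%:E)%E.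
Proof. by rewrite lee_fin mulr_ge0 ?powR_ge0 ?normal_pdf_ge0. Qed.

Let J_lower q k : 0 <= q -> 1 < k ->
  ((k `^ (- (q + 1)))%:E * J q +
   ((k ^+ 2 - 1) / 2)%:E * ((k `^ (- (q + 2 + 1)))%:E * J (q + 2)) <= J q)%E.
Proof.
move=> q0 k1; have k0 : 0 < k by lra.
have h0 : 0 <= (k ^+ 2 - 1) / 2 by nra.
rewrite -!J_scale// -ge0_integralZl//; last exact: mJpdf.
rewrite -ge0_integralD//; first last.
- by apply: emeasurable_funM => //; exact: mJpdf.
- by move=> s _; rewrite mule_ge0.
- exact: mJpdf.
rewrite [X in (_ <= X)%E]JE; apply: ge0_le_integral => //.
- move=> s _; rewrite -EFinM -EFinD lee_fin addr_ge0//.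
    by rewrite mulr_ge0 ?powR_ge0 ?normal_pdf_ge0.
  by rewrite mulr_ge0// mulr_ge0 ?powR_ge0 ?normal_pdf_ge0.
- by apply: emeasurable_funD; [exact: mJpdf|apply: emeasurable_funM => //; exact: mJpdf].
- exact: mJpdf0.
move=> s _; rewrite -EFinM -EFinD lee_fin powR2//.
have := ler_wpM2l (powR_ge0 `|s| q) (pdf_lower k s).
by move: (s : R) (pdf _) (pdf _) (_ `^ _) => x u v w; lra.
Qed.

Let J_upper q k : 0 <= q -> 1 < k ->
  (J q <= (k `^ (- (q + 1)))%:E * J q + ((k ^+ 2 - 1) / 2)%:E * J (q + 2))%E.
Proof.
move=> q0 k1; have k0 : 0 < k by lra.
have h0 : 0 <= (k ^+ 2 - 1) / 2 by nra.
have n1 p (x : R) : (0 <= (`|x| `^ p * pdf x)%:E)%E.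
  by rewrite lee_fin mulr_ge0 ?powR_ge0 ?normal_pdf_ge0.
rewrite -J_scale// [J (q + 2)]JE -ge0_integralZl//; last exact: mJpdf0.
rewrite -ge0_integralD//; first last.
- by apply: emeasurable_funM => //; exact: mJpdf0.
- by move=> s _; apply: mule_ge0; [rewrite lee_fin|exact: n1].
- exact: mJpdf.
rewrite [X in (X <= _)%E]JE; apply: ge0_le_integral => //.
- exact: mJpdf0.
- by apply: emeasurable_funD; [exact: mJpdf|apply: emeasurable_funM => //; exact: mJpdf0].
move=> s _; rewrite -EFinM -EFinD lee_fin powR2//.
have := ler_wpM2l (powR_ge0 `|s| q) (pdf_upper k s).
by move: (s : R) (pdf _) (pdf _) (_ `^ _) => x u v w; lra.
Qed.

Let J_ge0 q : (0 <= J q)%E.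
Proof. by apply: integral_ge0 => s _; rewrite lee_fin powR_ge0. Qed.

Let le_of_perturbation (x y C : R) : 0 <= x -> 0 <= C ->
  (forall e, 0 < e -> (1 - C * e) * x <= y) -> x <= y.
Proof.
move=> x0 C0 H; apply/ler_addgt0Pr => e e0.
have D0 : 0 < C * x + 1 by rewrite ltr_wpDl// mulr_ge0.
have := H _ (divr_gt0 e0 D0).
have : C * x * (e / (C * x + 1)) <= e.
  by rewrite mulrA ler_pdivrMr// mulrC ler_pM2l//; lra.
lra.
Qed.

Let expR_lower (x : R) : x * expR (- x) <= 1 - expR (- x).
Proof.
have := expR_ge1Dx x; have := expR_gt0 (- x).
have : expR x * expR (- x) = 1 by rewrite -expRD subrr expR0.
nra.
Qed.

Let expR_upper (x : R) : 1 - expR (- x) <= x.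
Proof. by have := expR_ge1Dx (- x); lra. Qed.

Let J_fin q : 0 <= q -> (J q < +oo)%E -> (J (q + 2) < +oo)%E.
Proof.
move=> q0 Jq; rewrite ltey; apply/eqP => J2.
have := @J_lower q 2 q0 ltac:(lra); rewrite J2.
rewrite gt0_muley ?lte_fin ?powR_gt0// gt0_muley ?lte_fin; last lra.
rewrite addey; last first.
  by rewrite -ltNye (lt_le_trans _ (mule_ge0 _ (J_ge0 q))) ?ltNyr// lee_fin powR_ge0.
by rewrite leye_eq => /eqP Jy; rewrite Jy ltxx in Jq.
Qed.

(** Integration by parts without derivatives: by [J_scale] a dilation by
    [k = expR e] multiplies the moment of order [q] by [expR (- (q + 1) e)], and by
    [pdf_lower] and [pdf_upper] the change of density costs [e] times the moment of
    order [q + 2], up to higher order.  Let [e] tend to 0. *)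
Lemma gauss_moment_rec q : 0 <= q ->
  (\int[gauss]_s (`|s| `^ q)%:E < +oo)%E ->
  (\int[gauss]_s (`|s| `^ (q + 2))%:E =
   (q + 1)%:E * \int[gauss]_s (`|s| `^ q)%:E)%E.
Proof.
move=> q0 Jq; have Jq2 := J_fin q0 Jq; rewrite -/(J q) -/(J (q + 2)).
have HL e (e0 : 0 < e) := @J_lower q (expR e) q0 (etrans (expR_gt1 e) e0).
have HU e (e0 : 0 < e) := @J_upper q (expR e) q0 (etrans (expR_gt1 e) e0).
move: HL HU Jq Jq2 (J_ge0 q) (J_ge0 (q + 2)); rewrite -/(J q).
case: (J q) => [j| |]//; case: (J (q + 2)) => [j2| |]// HL HU _ _.
rewrite !lee_fin => j0 j20; rewrite -EFinM; congr EFin.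
have kE (e x : R) : expR e `^ (- x) = expR (- (x * e)) by rewrite -expRM mulrN mulrC.
have k2E (e : R) : expR e ^+ 2 * expR (- (2 * e)) = 1.
  by rewrite -expRM_natl -expRD subrr expR0.
apply/eqP; rewrite eq_le; apply/andP; split.
  apply: (@le_of_perturbation _ _ (q + 3)) => // [|e e0]; first lra.
  have := HL e e0; rewrite -!EFinM -EFinD lee_fin !kE.
  have := expR_upper ((q + 1) * e); have := expR_ge1Dx (- ((q + 2 + 1) * e)).
  have := expR_ge1Dx e; move: (expR_ge0 (- ((q + 2 + 1) * e))).
  move: (expR e) (expR (- ((q + 2 + 1) * e))) (expR (- ((q + 1) * e))) => k B A.
  move=> B0 h1 h2 h3 h4.
  have hk : e <= (k ^+ 2 - 1) / 2 by nra.
  have BJ0 : 0 <= B * j2 by exact: mulr_ge0.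
  have h5 : e * (B * j2) <= (k ^+ 2 - 1) / 2 * (B * j2) by exact: ler_wpM2r.
  have h6 : (1 - A) * j <= (q + 1) * e * j by exact: ler_wpM2r.
  have h7 : B * j2 <= (q + 1) * j by rewrite -(ler_pM2l e0); lra.
  have h8 : (1 - (q + 2 + 1) * e) * j2 <= B * j2 by exact: ler_wpM2r.
  lra.
apply: (@le_of_perturbation _ _ (q + 3)) => // [||e e0]; [|lra|].
  by rewrite mulr_ge0//; lra.
have := HU e e0; rewrite -!EFinM -EFinD lee_fin !kE.
have := k2E e; have := expR_upper (2 * e); have := expR_lower ((q + 1) * e).
have hD : 1 - (q + 3) * e <= expR (- (2 * e)) * expR (- ((q + 1) * e)).
  rewrite -expRD (_ : - (2 * e) + _ = - ((q + 3) * e)); last by ring.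
  exact: expR_ge1Dx.
move: hD; have := expR_ge0 (- (2 * e)); have := expR_ge0 (- ((q + 1) * e)).
move: (expR e) (expR (- (2 * e))) (expR (- ((q + 1) * e))) => k m A.
move=> A0 m0 hD hA hm km h.
have h1 : m * ((1 - A) * j) <= m * ((k ^+ 2 - 1) / 2 * j2) by apply: ler_wpM2l => //; lra.
have h2 : m * ((k ^+ 2 - 1) / 2 * j2) = (1 - m) / 2 * j2.
  have h0 : k ^+ 2 * m * j2 = j2 by rewrite km mul1r.
  by lra.
have h3 : (1 - m) / 2 * j2 <= e * j2 by apply: ler_wpM2r => //; lra.
have h4 : m * ((q + 1) * e * A * j) <= m * ((1 - A) * j).
  by apply: ler_wpM2l => //; exact: ler_wpM2r.
have h5 : (m * A) * ((q + 1) * j) <= j2 by rewrite -(ler_pM2l e0); lra.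
apply: le_trans h5; apply: ler_wpM2r => //.
by rewrite mulr_ge0//; lra.
Qed.

End moments.

(** * Functions with moments of all orders *)

Section allmom.
Context d (U : measurableType d) (R : realType) (m : probability U R).
Implicit Types f g : U -> R.

(** The functions with finite moments of all orders form an algebra.  As this
    condition, unlike integrability, passes to products, the integrability of a
    Gaussian integrand is checked by following the shape of the expression. *)
Definition all_moments f :=
  measurable_fun [set: U] f /\ forall k, (\int[m]_x (`|f x| ^+ k)%:E < +oo)%E.

Let mabsX f k : measurable_fun [set: U] f ->
  measurable_fun [set: U] (fun x => (`|f x| ^+ k)%:E).
Proof.
move=> mf; apply/measurable_EFinP; apply: measurable_funX.
exact: measurableT_comp.
Qed.

Lemma all_moments_le f g : measurable_fun [set: U] f ->
  (forall x, `|f x| <= g x) -> all_moments g -> all_moments f.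
Proof.
move=> mf fg [mg gk]; split => // k; apply: le_lt_trans (gk k).
apply: ge0_le_integral => //.
- exact: mabsX.
- exact: mabsX.
by move=> x _; rewrite lee_fin lerXn2r ?nnegrE// (le_trans (fg x))// ler_norm.
Qed.

Lemma all_moments_cst c : all_moments (fun=> c).
Proof.
split=> [|k]; first exact: measurable_cst.
by apply: (@le_lt_trans _ _ (`|c| ^+ k)%:E); [rewrite probability_integral_cst|exact: ltry].
Qed.

Lemma all_momentsM f g : all_moments f -> all_moments g ->
  all_moments (fun x => f x * g x).
Proof.
move=> [mf fk] [mg gk]; split => [|k]; first exact: measurable_funM.
apply: (@le_lt_trans _ _ (\int[m]_x ((`|f x| ^+ (2 * k))%:E + (`|g x| ^+ (2 * k))%:E))%E).
  apply: ge0_le_integral => //.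
  - by apply: mabsX; exact: measurable_funM.
  - by apply: emeasurable_funD; exact: mabsX.
  move=> x _; rewrite -EFinD lee_fin normrM exprMn !(mulnC 2%N) !exprM.
  have := exprn_ge0 k (normr_ge0 (f x)); have := exprn_ge0 k (normr_ge0 (g x)).
  move: (`|f x| ^+ k) (`|g x| ^+ k) => a b a0 b0; nra.
rewrite ge0_integralD//; [|exact: mabsX..].
exact: lte_add_pinfty.
Qed.

Lemma all_momentsD f g : all_moments f -> all_moments g ->
  all_moments (fun x => f x + g x).
Proof.
move=> [mf fk] [mg gk]; split => [|k]; first exact: measurable_funD.
apply: (@le_lt_trans _ _
  (\int[m]_x ((2 ^+ k)%:E * ((`|f x| ^+ k)%:E + (`|g x| ^+ k)%:E)))%E).
  apply: ge0_le_integral => //.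
  - by apply: mabsX; exact: measurable_funD.
  - by apply: emeasurable_funM => //; apply: emeasurable_funD; exact: mabsX.
  move=> x _; rewrite -EFinD -EFinM lee_fin.
  apply: (@le_trans _ _ ((2 * Num.max `|f x| `|g x|) ^+ k)).
    rewrite lerXn2r ?nnegrE ?mulr_ge0 ?le_max ?normr_ge0//.
    rewrite (le_trans (ler_normD _ _))// mulr_natl mulr2n lerD// le_max lexx ?orbT//.
  rewrite exprMn ler_wpM2l ?exprn_ge0//.
  by case: (leP `|f x| `|g x|) => _; rewrite ?lerDl ?lerDr exprn_ge0.
have m1 f' : measurable_fun setT f' -> measurable_fun setT (fun x => (`|f' x| ^+ k)%:E).
  by move=> mf'; exact: mabsX.
have n1 f' x : (0 <= (`|f' x : R| ^+ k)%:E)%E by rewrite lee_fin exprn_ge0.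
rewrite ge0_integralZl//; first last.
- by move=> x _; apply: adde_ge0; exact: n1.
- by apply: emeasurable_funD; exact: m1.
rewrite ge0_integralD//; [|exact: m1|exact: m1].
by rewrite lte_mul_pinfty ?lee_fin ?exprn_ge0//; exact: lte_add_pinfty.
Qed.

Lemma all_moments_norm f : all_moments f -> all_moments (fun x => `|f x|).
Proof.
move=> [mf fk]; split => [|k]; first exact: measurableT_comp.
by under eq_integral do rewrite normr_id.
Qed.

Lemma all_momentsX f k : all_moments f -> all_moments (fun x => f x ^+ k).
Proof.
move=> af; elim: k => [|k IH]; first exact: all_moments_cst.
by have := all_momentsM af IH; under eq_fun do rewrite -exprS.
Qed.

Lemma all_moments_sum I (s : seq I) (Q : pred I) (F : I -> U -> R) :
  (forall i, all_moments (F i)) -> all_moments (fun x => \sum_(i <- s | Q i) F i x).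
Proof.
move=> aF; elim: s => [|i s IH].
  by under eq_fun do rewrite big_nil; exact: all_moments_cst.
have [Qi|/negbTE Qi] := boolP (Q i); under eq_fun do rewrite big_cons Qi.
  exact: all_momentsD.
exact: IH.
Qed.

Lemma all_moments_horner (p : {poly R}) f : all_moments f ->
  all_moments (fun x => p.[f x]).
Proof.
move=> af; under eq_fun do rewrite horner_coef.
apply: all_moments_sum => i; apply: all_momentsM; first exact: all_moments_cst.
exact: all_momentsX.
Qed.

Lemma all_moments_powR (q : R) f : 0 <= q -> all_moments f ->
  all_moments (fun x => `|f x| `^ q).
Proof.
move=> q0 af; pose n := (Num.truncn q).+1.
apply: (@all_moments_le _ (fun x => 1 + `|f x| ^+ n)).
- apply: (measurableT_comp (measurable_powR q)).
  by case: af => ? _; exact: measurableT_comp.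
- move=> x; rewrite ger0_norm ?powR_ge0//.
  have [f1|f1] := leP `|f x| 1.
    rewrite (@le_trans _ _ 1)//; last by rewrite lerDl exprn_ge0.
    by have := @ge0_ler_powR _ q q0 `|f x| 1; rewrite powR1; apply; rewrite ?nnegrE.
  by rewrite -powR_mulrn// ler_wpDl// ler_powR// ltW// truncnS_gt.
apply: all_momentsD; first exact: all_moments_cst.
by apply: all_momentsX; exact: all_moments_norm.
Qed.

Lemma all_moments_integrable f : all_moments f -> m.-integrable setT (EFin \o f).
Proof.
move=> [mf fk]; apply/integrableP; split; first exact/measurable_EFinP.
exact: (fk 1%N).
Qed.

Lemma all_moments_RintegralD f g : all_moments f -> all_moments g ->
  \int[m]_x (f x + g x) = \int[m]_x f x + \int[m]_x g x.
Proof. by move=> af ag; rewrite RintegralD//; exact: all_moments_integrable. Qed.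

Lemma all_moments_RintegralB f g : all_moments f -> all_moments g ->
  \int[m]_x (f x - g x) = \int[m]_x f x - \int[m]_x g x.
Proof. by move=> af ag; rewrite RintegralB//; exact: all_moments_integrable. Qed.

Lemma all_moments_RintegralZl f c : all_moments f ->
  \int[m]_x (c * f x) = c * \int[m]_x f x.
Proof. by move=> af; rewrite RintegralZl//; exact: all_moments_integrable. Qed.

Lemma probability_Rintegral_cst c : \int[m]_x c = c.
Proof.
rewrite /Rintegral (_ : \int[m]_x _ = c%:E)%E//.
exact: probability_integral_cst.
Qed.

Lemma all_moments_Rintegral_sum I (s : seq I) (F : I -> U -> R) :
  (forall i, all_moments (F i)) ->
  \int[m]_x (\sum_(i <- s) F i x) = \sum_(i <- s) \int[m]_x F i x.
Proof.
move=> aF; elim: s => [|i s IH].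
  by under eq_Rintegral do rewrite big_nil; rewrite probability_Rintegral_cst big_nil.
under eq_Rintegral do rewrite big_cons.
rewrite all_moments_RintegralD// ?big_cons ?IH//.
exact: all_moments_sum.
Qed.

Lemma all_moments_RintegralE f : all_moments f ->
  (\int[m]_x (f x)%:E = (\int[m]_x f x)%:E)%E.
Proof.
move=> af; rewrite /Rintegral fineK//.
by apply: integrable_fin_num => //; exact: all_moments_integrable.
Qed.

End allmom.

(** * Products and absolute Gaussian moments *)

Section product.
Context d1 d2 (T1 : measurableType d1) (T2 : measurableType d2) (R : realType).
Variables (m1 : probability T1 R) (m2 : probability T2 R).

Let prodT : (m1 \x m2)%E [set: T1 * T2] = 1%E.
Proof.
rewrite -setXTT product_measure1E//.
by apply: (etrans (congr2 mule (probability_setT m1) (probability_setT m2))); exact: mule1.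
Qed.

Let prodM : {measure set (T1 * T2) -> \bar R} := (m1 \x m2)%E.

Definition product_probability : probability (T1 * T2)%type R :=
  HB.pack (Measure.sort prodM) (Measure.class prodM)
    (Measure_isProbability.Build _ _ _ prodM prodT).

Lemma all_moments_fst f : all_moments m1 f ->
  all_moments product_probability (fun z => f z.1).
Proof.
move=> [mf fk]; split => [|k]; first exact: measurableT_comp mf measurable_fst.
have mF : measurable_fun setT (fun z : T1 * T2 => (`|f z.1| ^+ k)%:E).
  apply/measurable_EFinP; apply: measurable_funX; apply: measurableT_comp => //.
  exact: measurableT_comp mf measurable_fst.
apply: le_lt_trans (fk k); rewrite le_eqVlt; apply/orP; left; apply/eqP.
apply: (etrans (@fubini_tonelli1 _ _ T1 T2 R m1 m2 _ mF _)) => //.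
by apply: eq_integral => x _; exact: (probability_integral_cst m2 (`|f x| ^+ k)%:E).
Qed.

Lemma all_moments_snd f : all_moments m2 f ->
  all_moments product_probability (fun z => f z.2).
Proof.
move=> [mf fk]; split => [|k]; first exact: measurableT_comp mf measurable_snd.
have mF : measurable_fun setT (fun z : T1 * T2 => (`|f z.2| ^+ k)%:E).
  apply/measurable_EFinP; apply: measurable_funX; apply: measurableT_comp => //.
  exact: measurableT_comp mf measurable_snd.
apply: le_lt_trans (fk k); rewrite le_eqVlt; apply/orP; left; apply/eqP.
apply: (etrans (@fubini_tonelli1 _ _ T1 T2 R m1 m2 _ mF _)) => //.
exact: (probability_integral_cst m1 (\int[m2]_y (`|f y| ^+ k)%:E)%E).
Qed.

Lemma all_moments_fubini f : all_moments product_probability f ->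
  (forall x, all_moments m2 (fun y => f (x, y))) ->
  \int[product_probability]_z f z = \int[m1]_x \int[m2]_y f (x, y).
Proof.
move=> af afx; rewrite /Rintegral; congr fine.
have h := @integral12_prod_meas1 _ _ T1 T2 R m1 m2 (EFin \o f) (all_moments_integrable af).
apply: (etrans (esym h)); apply: eq_integral => x _.
by rewrite -all_moments_RintegralE.
Qed.

End product.

Section gauss_moments.
Context {R : realType}.
Local Notation gauss := (@gauss R).

Let J (q : R) := (\int[gauss]_s (`|s| `^ q)%:E)%E.

Let J0 : J 0 = 1%E.
Proof.
rewrite /J (_ : \int[_]_x _ = \int[gauss]_x 1%E)%E.
  exact: probability_integral_cst.
by apply: eq_integral => x _; rewrite powRr0.
Qed.

Let J_even k : (J (2 * k)%:R < +oo)%E.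
Proof.
elim: k => [|k IH]; first by rewrite muln0 J0 ltry.
rewrite mulnS addnC natrD /J gauss_moment_rec//.
by apply: lte_mul_pinfty => //; rewrite lee_fin addr_ge0.
Qed.

Lemma all_moments_gauss : all_moments gauss (fun s : R => s).
Proof.
split => // k; apply: (@le_lt_trans _ _ (\int[gauss]_s (1 + (`|s| `^ (2 * k)%:R)%:E))%E).
  have mk n : measurable_fun [set: R] (fun x : R => (`|x| ^+ n)%:E).
    by apply/measurable_EFinP; apply: measurable_funX; exact: (@normr_measurable R setT).
  apply: ge0_le_integral => //.
  - exact: mk.
  - apply: emeasurable_funD => //; have := mk (2 * k)%N; congr (measurable_fun _ _).
    by apply/funext => x; rewrite powR_mulrn.
  move=> x _; rewrite -EFinD lee_fin powR_mulrn// mulnC exprM.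
  by move: (`|x| ^+ k) => y; nra.
rewrite ge0_integralD//; last first.
  apply/measurable_EFinP; apply: (measurableT_comp (measurable_powR _)).
  exact: (@normr_measurable R setT).
rewrite lte_add_pinfty//; last exact: J_even.
by apply: le_lt_trans (ltry 1%R); rewrite le_eqVlt; apply/orP; left; apply/eqP;
  exact: probability_integral_cst.
Qed.

Definition abs_moment (q : R) : R := \int[gauss]_s (`|s| `^ q).

Lemma all_moments_gauss_powR q : 0 <= q -> all_moments gauss (fun s : R => `|s| `^ q).
Proof. by move=> q0; apply: all_moments_powR => //; exact: all_moments_gauss. Qed.

Lemma abs_momentE q : 0 <= q -> J q = (abs_moment q)%:E.
Proof. by move=> q0; rewrite /J all_moments_RintegralE//; exact: all_moments_gauss_powR. Qed.

Lemma abs_moment_rec q : 0 <= q -> abs_moment (q + 2) = (q + 1) * abs_moment q.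
Proof.
move=> q0; apply: EFin_inj; rewrite EFinM -!abs_momentE//; last by rewrite addr_ge0.
by apply: gauss_moment_rec => //; rewrite -/(J q) abs_momentE ?ltry.
Qed.

Lemma abs_moment0 : abs_moment 0 = 1.
Proof. by apply: EFin_inj; rewrite -abs_momentE. Qed.

(** For [0 <= q <= 2] the function [|s| `^ q] is at least [s^2 / 4 - s^4 / 16], of
    integral [1 / 4 - 3 / 16]. *)
Lemma abs_moment_gt0 q : 0 <= q -> q <= 2 -> 0 < abs_moment q.
Proof.
move=> q0 q2.
have m2 : abs_moment 2 = 1 by rewrite -[2]add0r abs_moment_rec// abs_moment0 mulr1 add0r.
have m4 : abs_moment 4 = 3.
  by rewrite (_ : 4 = 2 + 2 :> R) ?abs_moment_rec// ?m2 ?mulr1//; lra.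
have al := @all_moments_gauss_powR.
have nn (k : nat) : (0 : R) <= k%:R by [].
apply: (@lt_le_trans _ _ (4^-1 * abs_moment 2 - 16^-1 * abs_moment 4)).
  by rewrite m2 m4; lra.
rewrite /abs_moment -!all_moments_RintegralZl; [|exact: al..].
rewrite -all_moments_RintegralB; first last.
- by apply: all_momentsM; [exact: all_moments_cst|exact: al].
- by apply: all_momentsM; [exact: all_moments_cst|exact: al].
apply: le_Rintegral => //.
- apply: all_moments_integrable; apply: all_momentsD.
    by apply: all_momentsM; [exact: all_moments_cst|exact: al].
  have := all_momentsM (all_moments_cst gauss (-1))
    (all_momentsM (all_moments_cst gauss 16^-1) (al 4 _)).
  by under eq_fun do rewrite mulN1r; apply.
- exact/all_moments_integrable/al.
move=> x _; rewrite !powR_mulrn//.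
have [x1|x1] := leP `|x| 1.
  apply: (@le_trans _ _ (`|x| ^+ 2)).
    by have := normr_ge0 x; move: `|x| x1 => y; nra.
  have [->|x0] := eqVneq `|x| 0; first by rewrite expr0n powR_ge0.
  rewrite -powR_mulrn// ger_powR// x1 andbT lt_def x0/=; exact: normr_ge0.
apply: (@le_trans _ _ 1); last first.
  by rewrite -(powRr0 `|x|) ler_powR// ltW.
by move: `|x| x1 => y; nra.
Qed.

(** The reflection of a Gaussian variable is the first coordinate of a half turn. *)
Lemma Rintegral_gauss_opp (f : R -> R) : measurable_fun setT f ->
  \int[gauss]_s f (- s) = \int[gauss]_s f s.
Proof.
move=> mf; rewrite /Rintegral; congr fine.
have ge0 (h : R -> \bar R) : measurable_fun setT h -> (forall x, (0 <= h x)%E) ->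
    (\int[gauss]_s h (- s)%R = \int[gauss]_s h s)%E.
  move=> mh h0.
  have mH : measurable_fun setT (fun z : R * R => h z.1).
    exact: measurableT_comp mh measurable_fst.
  have ab : (-1 : R) ^+ 2 + 0 ^+ 2 = 1 by rewrite sqrrN expr1n expr0n addr0.
  apply: (etrans _ (etrans (gauss_rotation ab mH (fun z => h0 _)) _)).
    apply: eq_integral => x _; apply: (etrans (esym (probability_integral_cst gauss _))).
    by apply: eq_integral => y _ /=; rewrite mul0r subr0 mulN1r.
  by apply: eq_integral => x _; exact: (probability_integral_cst gauss (h x)).
have mfE : measurable_fun setT (EFin \o f) by exact/measurable_EFinP.
rewrite integralE [RHS]integralE; congr (_ - _)%E.
  apply: (etrans _ (ge0 _ (measurable_funepos mfE) _)); last exact: funepos_ge0.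
  by apply: eq_integral => x _; rewrite !funeposE.
apply: (etrans _ (ge0 _ (measurable_funeneg mfE) _)); last exact: funeneg_ge0.
by apply: eq_integral => x _; rewrite !funenegE.
Qed.

Lemma Rintegral_gauss_odd (f : R -> R) : all_moments gauss f ->
  (forall s, f (- s) = - f s) -> \int[gauss]_s f s = 0.
Proof.
move=> af odd; have := Rintegral_gauss_opp (proj1 af).
under eq_Rintegral do rewrite odd -mulN1r.
rewrite all_moments_RintegralZl//; lra.
Qed.

End gauss_moments.

(** * Hermite polynomials *)

Section hermite.
Context {R : realType}.
Local Notation gauss := (@gauss R).
Implicit Types p : {poly R}.

Let all_moments_expr k : all_moments gauss (fun s : R => s ^+ k).
Proof. by apply: all_momentsX; exact: all_moments_gauss. Qed.

Let weight_moment (q : R) k := \int[gauss]_s (`|s| `^ q * s ^+ k).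

Let all_moments_weight q k : 0 <= q -> all_moments gauss (fun s : R => `|s| `^ q * s ^+ k).
Proof.
by move=> q0; apply: all_momentsM; [exact: all_moments_gauss_powR|exact: all_moments_expr].
Qed.

Let weight_moment_rec q k : 0 <= q ->
  weight_moment q k.+2 = (k%:R + q + 1) * weight_moment q k.
Proof.
move=> q0; have [ko|ke] := boolP (odd k).
  rewrite /weight_moment !Rintegral_gauss_odd ?mulr0//; try exact: all_moments_weight.
    by move=> s; rewrite normrN exprNn -signr_odd ko expr1 mulN1r mulrN.
  by move=> s; rewrite normrN exprNn -signr_odd /= negbK ko expr1 mulN1r mulrN.
have wE j : ~~ odd j -> weight_moment q j = abs_moment (q + j%:R).
  move=> je; apply: eq_Rintegral => s _.
  have -> : s ^+ j = `|s| ^+ j.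
    by rewrite -[j]odd_double_half (negbTE je) add0n -muln2 mulnC !exprM real_normK ?num_real.
  rewrite -powR_mulrn//; case: j je => [|j] je; first by rewrite powRr0 mulr1 addr0.
  by rewrite -powRD// gt_eqF// ltr_wpDl.
rewrite !wE//=; last by rewrite negbK.
rewrite -addn2 natrD addrA abs_moment_rec ?addr_ge0//; by congr (_ * _); ring.
Qed.

Definition weighted (q : R) p := \int[gauss]_s (`|s| `^ q * p.[s]).

Lemma all_moments_weighted q p : 0 <= q ->
  all_moments gauss (fun s : R => `|s| `^ q * p.[s]).
Proof.
move=> q0; apply: all_momentsM; first exact: all_moments_gauss_powR.
by apply: all_moments_horner; exact: all_moments_gauss.
Qed.

Lemma weightedD q p1 p2 : 0 <= q ->
  weighted q (p1 + p2) = weighted q p1 + weighted q p2.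
Proof.
move=> q0; rewrite /weighted -all_moments_RintegralD; try exact: all_moments_weighted.
by apply: eq_Rintegral => s _; rewrite hornerD mulrDr.
Qed.

Lemma weightedZ q c p : 0 <= q -> weighted q (c *: p) = c * weighted q p.
Proof.
move=> q0; rewrite /weighted -all_moments_RintegralZl; last exact: all_moments_weighted.
by apply: eq_Rintegral => s _; rewrite hornerZ mulrCA.
Qed.

Lemma weightedB q p1 p2 : 0 <= q ->
  weighted q (p1 - p2) = weighted q p1 - weighted q p2.
Proof. by move=> q0; rewrite -scaleN1r weightedD// weightedZ// mulN1r. Qed.

Lemma weighted1 q : weighted q 1 = abs_moment q.
Proof. by apply: eq_Rintegral => s _; rewrite hornerC mulr1. Qed.

Let weightedXn q k : weighted q 'X^k = weight_moment q k.
Proof. by apply: eq_Rintegral => s _; rewrite hornerXn. Qed.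

Lemma poly_monomial_ind (Q : {poly R} -> Prop) : Q 0 ->
  (forall p1 p2, Q p1 -> Q p2 -> Q (p1 + p2)) -> (forall c k, Q (c *: 'X^k)) ->
  forall p, Q p.
Proof.
move=> Q0 QD QX p; rewrite -(coefK p) poly_def.
by elim/big_rec: _ => // i x _ Qx; exact: QD.
Qed.

Let weighted_moment q k : 0 <= q -> weighted q 'X^(k.+2) = (k%:R + q + 1) * weighted q 'X^k.
Proof. by move=> q0; rewrite !weightedXn weight_moment_rec. Qed.

Let weighted0 q : 0 <= q -> weighted q 0 = 0.
Proof. by move=> q0; rewrite -(scale0r 0) weightedZ// mul0r. Qed.

Let mulX_deriv c k : 'X * (c *: 'X^k)^`() = (k%:R * c) *: 'X^k :> {poly R}.
Proof.
rewrite derivZ derivXn -scalerAr.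
case: k => [|k]; first by rewrite mulr0n mulr0 scaler0 mul0r scale0r.
by rewrite mulrnAr -exprS -scaler_nat scalerA mulrC.
Qed.

(** Integration by parts: the derivative of [s |s|^q e^{- s^2 / 2}] is
    [(q + 1 - s^2) |s|^q e^{- s^2 / 2}].  On monomials this is [abs_moment_rec]. *)
Lemma weighted_mulXX q p : 0 <= q ->
  weighted q ('X * ('X * p)) = (q + 1) * weighted q p + weighted q ('X * p^`()).
Proof.
move=> q0; elim/poly_monomial_ind: p => [|p1 p2 h1 h2|c k].
- by rewrite !mulr0 deriv0 mulr0 weighted0// mulr0 addr0.
- by rewrite derivD !mulrDr !weightedD// h1 h2; ring.
- rewrite mulX_deriv -!scalerAr -!exprS !weightedZ// weighted_moment//; ring.
Qed.

(** For [q = 0] a single factor ['X] can be integrated by parts. *)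
Lemma gauss_mulX p : weighted 0 ('X * p) = weighted 0 p^`().
Proof.
elim/poly_monomial_ind: p => [|p1 p2 h1 h2|c k].
- by rewrite mulr0 deriv0.
- by rewrite derivD mulrDr !weightedD// h1 h2.
- rewrite derivZ derivXn -scalerAr -exprS !weightedZ//; congr (_ * _).
  case: k => [|k].
    rewrite mulr0n weighted0// /weighted; apply: Rintegral_gauss_odd.
      exact: all_moments_weighted.
    by move=> s; rewrite !hornerXn !powRr0 !mul1r !expr1.
  by rewrite weighted_moment// -[_ *+ k.+1]scaler_nat weightedZ// addr0 -natr1.
Qed.

(** The monic orthogonal polynomials of the Gaussian law of variance [v].  The inner
    match gives the three-term recursion a meaning at degree one. *)
Fixpoint hermite (v : R) (m : nat) : {poly R} :=
  if m is m1.+1 then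
    'X * hermite v m1 - (m1%:R * v) *: (if m1 is m2.+1 then hermite v m2 else 0)
  else 1.

Lemma hermiteSS v m : hermite v m.+2 =
  'X * hermite v m.+1 - (m.+1%:R * v) *: hermite v m.
Proof. by []. Qed.

Lemma hermite1 v : hermite v 1 = 'X.
Proof. by rewrite /= mulr1 scaler0 subr0. Qed.

Lemma deriv_hermite v m : (hermite v m.+1)^`() = m.+1%:R *: hermite v m.
Proof.
suff [] : (hermite v m.+1)^`() = m.+1%:R *: hermite v m /\
  (hermite v m.+2)^`() = m.+2%:R *: hermite v m.+1 by [].
elim: m => [|m [IH1 IH2]].
  rewrite hermiteSS hermite1 derivX scale1r; split=> //.
  by rewrite derivB derivM derivX derivZ derivC scaler0 subr0 mul1r mulr1 -mulr2n scaler_nat.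
split => //; rewrite (hermiteSS _ m.+1) derivB derivM derivX mul1r derivZ IH1 IH2.
rewrite -scalerAr scalerA (mulrAC _ v) -mulrA -scalerA -addrA -scalerBr -hermiteSS.
by rewrite -{1}[hermite v m.+2]scale1r -scalerDl nat1r.
Qed.

(** Averaging over the part [e w] of a Gaussian variable [c s + e w] contracts the
    Hermite polynomial of degree [m] by [c ^+ m]: Hermite polynomials are the
    eigenfunctions of the Ornstein-Uhlenbeck semigroup. *)
Lemma hermite_average (c e s : R) m :
  weighted 0 (hermite (c ^+ 2 + e ^+ 2) m \Po ((c * s)%:P + e *: 'X)) =
  c ^+ m * (hermite 1 m).[s].
Proof.
set v := c ^+ 2 + e ^+ 2; set L := _ + _.
suff [] : weighted 0 (hermite v m \Po L) = c ^+ m * (hermite 1 m).[s] /\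
  weighted 0 (hermite v m.+1 \Po L) = c ^+ m.+1 * (hermite 1 m.+1).[s] by [].
have mulL p : weighted 0 (L * p) = c * s * weighted 0 p + e * weighted 0 p^`().
  by rewrite /L mulrDl mul_polyC -scalerAl weightedD// !weightedZ// gauss_mulX.
have derivL : L^`() = e%:P by rewrite /L derivD derivC derivZ derivX add0r alg_polyC.
have w1 : weighted 0 1 = 1 by rewrite weighted1 abs_moment0.
elim: m => [|m [IH1 IH2]].
  rewrite !hermite1 comp_polyX -[L]mulr1 mulL derivC weighted0// mulr0 addr0.
  by rewrite -polyC1 comp_polyC polyC1 w1 hornerC hornerX; split; ring.
split => //; rewrite !hermiteSS comp_polyB comp_polyM comp_polyX comp_polyZ.
rewrite weightedB// mulL weightedZ// deriv_comp deriv_hermite derivL.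
rewrite comp_polyZ -[_ *: _ * e%:P]scalerAl [_ * e%:P]mulrC mul_polyC !weightedZ// IH1 IH2.
move: (hermite 1 m.+1) (hermite 1 m) => p1 p0.
by rewrite hornerD hornerN hornerM hornerX hornerZ /v !exprS; ring.
Qed.

(** Odd degrees are left out because the weight is even. *)
Definition hermite_moment (q : R) k := weighted q (hermite 1 (2 * k)).

Lemma hermite_moment0 q : hermite_moment q 0 = abs_moment q.
Proof. by rewrite /hermite_moment muln0 weighted1. Qed.

Lemma hermite_moment1 q : 0 <= q -> hermite_moment q 1 = q * abs_moment q.
Proof.
move=> q0; rewrite /hermite_moment muln1 hermiteSS hermite1 !mulr1 weightedB// weightedZ//.
rewrite -{2}['X]mulr1 weighted_mulXX// derivC mulr0 weighted0// weighted1; ring.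
Qed.

(** The quotient of [hermite 1 (2 * k + 1)] by ['X]. *)
Let odd_quotient := fix W k : {poly R} :=
  if k is k'.+1 then hermite 1 (2 * k) - (2 * k)%:R *: W k' else 1.

Let odd_quotientS k : odd_quotient k.+1 =
  hermite 1 (2 * k.+1) - (2 * k.+1)%:R *: odd_quotient k.
Proof. by []. Qed.

Let hermite_odd k : hermite 1 (2 * k).+1 = 'X * odd_quotient k.
Proof.
elim: k => [|k IH]; first by rewrite muln0 hermite1 mulr1.
rewrite odd_quotientS mulrBr mulnS !add2n (hermiteSS 1 (2 * k).+1) IH mulr1.
by rewrite -scalerAr.
Qed.

(** One factor ['X] from the three-term recursion and one from the odd polynomial
    allow an integration by parts against [|s|]. *)
Let hermite_moment_odd_quotient k : hermite_moment 1 k.+1 = weighted 1 (odd_quotient k).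
Proof.
have l01 : 0 <= 1 :> R by [].
rewrite /hermite_moment mulnS add2n hermiteSS weightedB// weightedZ// hermite_odd.
rewrite weighted_mulXX//.
have := congr1 (weighted 1) (deriv_hermite 1 (2 * k)).
rewrite hermite_odd derivM derivX mul1r weightedD// weightedZ// mulr1 => <-; ring.
Qed.

Let odd_quotient_rec k :
  weighted 1 (odd_quotient k.+1) = - (2 * k).+1%:R * weighted 1 (odd_quotient k).
Proof.
have l01 : 0 <= 1 :> R by [].
rewrite odd_quotientS weightedB// weightedZ// -/(hermite_moment 1 k.+1).
rewrite hermite_moment_odd_quotient mulnS add2n -!natr1; ring.
Qed.

Lemma hermite_moment2 : hermite_moment 1 2 = - abs_moment 1.
Proof.
by rewrite hermite_moment_odd_quotient odd_quotient_rec muln0 weighted1 mulN1r.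
Qed.

(** The moments of the quotients by ['X] satisfy a recursion of order one, so they
    are all nonzero multiples of [abs_moment 1]. *)
Lemma hermite_moment_neq0 k : hermite_moment 1 k != 0.
Proof.
have a1 : abs_moment 1 != 0 :> R by rewrite gt_eqF// abs_moment_gt0//; lra.
case: k => [|k]; first by rewrite hermite_moment0.
rewrite hermite_moment_odd_quotient; elim: k => [|k IH]; first by rewrite weighted1.
by rewrite odd_quotient_rec mulf_neq0// oppr_eq0 pnatr_eq0.
Qed.

End hermite.

(** * Linear forms of a Gaussian vector *)

Section gaussian_vector.
Context {R : realType} (n : nat).
Local Notation P := (@unif01 R).
Local Notation gauss := (@gauss R).
Local Notation gauss2 := (product_probability gauss gauss).

Variables (g : 'I_n -> R -> R) (gg : gaussian_vector g).

Definition dot (x y : 'I_n -> R) : R := \sum_i x i * y i.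
Definition unitvec (i j : 'I_n) : R := (j == i)%:R.

Lemma dot_unitvec i (x : 'I_n -> R) : dot (unitvec i) x = x i.
Proof.
rewrite /dot (bigD1 i)//= /unitvec eqxx mul1r big1 ?addr0// => j /negbTE ->.
by rewrite mul0r.
Qed.

Lemma dotC (x y : 'I_n -> R) : dot x y = dot y x.
Proof. by apply: eq_bigr => i _; rewrite mulrC. Qed.

Lemma dotDl (x y z : 'I_n -> R) : dot (fun i => x i + y i) z = dot x z + dot y z.
Proof. by rewrite /dot -big_split/=; apply: eq_bigr => i _; rewrite mulrDl. Qed.

Lemma dotBl (x y z : 'I_n -> R) : dot (fun i => x i - y i) z = dot x z - dot y z.
Proof. by rewrite /dot -sumrB; apply: eq_bigr => i _; rewrite mulrBl. Qed.

Lemma dot_ge0 (x : 'I_n -> R) : 0 <= dot x x.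
Proof. by apply: sumr_ge0 => i _; exact: sqr_ge0. Qed.

Notation vec t := (g^~ t).

Lemma measurable_dot x : measurable_fun setT (fun t => dot x (vec t)).
Proof. by apply: measurable_sum => j; apply: measurable_funM => //; exact: (proj1 gg). Qed.

Lemma all_moments_dot x : all_moments P (fun t => dot x (vec t)).
Proof.
split=> [|k]; first exact: measurable_dot.
have [a [c [e [_ _ _ law]]]] := (proj2 gg) x x.
have mF : measurable_fun [set: R * R] (fun z : R * R => (`|z.1| ^+ k)%:E).
  apply/measurable_EFinP; apply: measurable_funX.
  exact: measurableT_comp (@normr_measurable R setT) measurable_fst.
have F0 (z : R * R) : (0 <= (`|z.1| ^+ k)%:E)%E by rewrite lee_fin exprn_ge0.
rewrite (law _ mF F0).
have [_ /(_ k)] : all_moments gauss (fun s : R => a * s).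
  by apply: all_momentsM; [exact: all_moments_cst|exact: all_moments_gauss].
apply: le_lt_trans; rewrite le_eqVlt; apply/orP; left; apply/eqP.
by apply: eq_integral => s _; exact: (probability_integral_cst gauss (`|a * s| ^+ k)%:E).
Qed.

Lemma all_moments_coord i : all_moments P (g i).
Proof. by have := all_moments_dot (unitvec i); under eq_fun do rewrite dot_unitvec. Qed.

(** Stated for the product probability so that [all_moments] applies on both sides;
    positive and negative parts reduce it to nonnegative integrands. *)
Lemma gaussian_vector_law x y : exists a c e : R,
  [/\ a ^+ 2 = dot x x, a * c = dot x y, c ^+ 2 + e ^+ 2 = dot y y
    & forall f : R * R -> R, measurable_fun setT f ->
      \int[P]_t f (dot x (vec t), dot y (vec t)) =
      \int[gauss2]_z f (a * z.1, c * z.1 + e * z.2)].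
Proof.
have [a [c [e [a2 ac ce law]]]] := (proj2 gg) x y.
exists a, c, e; split => // f mf.
have mlin : measurable_fun [set: R * R] (fun z : R * R => (a * z.1, c * z.1 + e * z.2)).
  have := @measurable_linear2 R a 0 c e; congr (measurable_fun _ _).
  by apply/funext => z; rewrite mul0r addr0.
have ge0 (F : R * R -> \bar R) : measurable_fun setT F -> (forall z, (0 <= F z)%E) ->
    (\int[P]_t F (dot x (vec t), dot y (vec t)) =
     \int[gauss2]_z F (a * z.1, c * z.1 + e * z.2)%R)%E.
  move=> mF F0; apply: (etrans (law F mF F0)); apply/esym.
  exact: (@fubini_tonelli1 _ _ (measurableTypeR R) (measurableTypeR R) R gauss gauss _
    (measurableT_comp mF mlin) (fun z => F0 _)).
have mfE : measurable_fun setT (EFin \o f) by exact/measurable_EFinP.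
rewrite /Rintegral; congr fine; rewrite integralE [RHS]integralE; congr (_ - _)%E.
  apply: (etrans _ (etrans (ge0 _ (measurable_funepos mfE) _) _)); last 2 first.
  - exact: funepos_ge0.
  - by apply: eq_integral => z _; rewrite !funeposE.
  - by apply: eq_integral => z _; rewrite !funeposE.
apply: (etrans _ (etrans (ge0 _ (measurable_funeneg mfE) _) _)); last 2 first.
- exact: funeneg_ge0.
- by apply: eq_integral => z _; rewrite !funenegE.
- by apply: eq_integral => z _; rewrite !funenegE.
Qed.

Let am1 : all_moments gauss2 (fun z : R * R => z.1).
Proof. exact: all_moments_fst (all_moments_gauss). Qed.
Let am2 : all_moments gauss2 (fun z : R * R => z.2).
Proof. exact: all_moments_snd (all_moments_gauss). Qed.

(** A Funk-Hecke formula.  Given [<x, g>], the variable [<y, g>] keeps a component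
    [c s] along it and an independent Gaussian one, which [hermite_average]
    integrates out; [c ^+ 2] is the square of the projection of [y] on the line of
    [x]. *)
Lemma hermite_dot (q : R) k x y : 0 <= q -> 0 < dot x x ->
  \int[P]_t (`|dot x (vec t)| `^ q * (hermite (dot y y) (2 * k)).[dot y (vec t)]) =
  Num.sqrt (dot x x) `^ q * (dot x y ^+ 2 / dot x x) ^+ k * hermite_moment q k.
Proof.
move=> q0 x0; have [a [c [e [a2 ac ce law]]]] := gaussian_vector_law x y.
set H := hermite _ _.
have mF : measurable_fun setT (fun z : R * R => `|z.1| `^ q * H.[z.2]).
  apply: measurable_funM; first exact: (proj1 (all_moments_powR q0 am1)).
  exact: (proj1 (all_moments_horner H am2)).
rewrite (law _ mF)/=.
have aml : all_moments gauss (fun s : R => s) := all_moments_gauss.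
have ama k' : all_moments gauss (fun s : R => k' * s).
  by apply: all_momentsM => //; exact: all_moments_cst.
rewrite all_moments_fubini/=; first last.
- move=> s; apply: all_momentsM; first exact: all_moments_cst.
  by apply: all_moments_horner; apply: all_momentsD; [exact: all_moments_cst|exact: ama].
- apply: all_momentsM.
    by apply: all_moments_powR => //; apply: all_momentsM => //; exact: all_moments_cst.
  apply: all_moments_horner; apply: all_momentsD; apply: all_momentsM => //;
  exact: all_moments_cst.
have -> : Num.sqrt (dot x x) = `|a| by rewrite -a2 sqrtr_sqr.
have -> : dot x y ^+ 2 / dot x x = c ^+ 2.
  by rewrite -ac -a2 exprMn mulrC mulKf// a2 gt_eqF.
rewrite -exprM /hermite_moment /weighted -all_moments_RintegralZl; last first.
  exact: all_moments_weighted.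
apply: eq_Rintegral => s _; rewrite all_moments_RintegralZl; last first.
  by apply: all_moments_horner; apply: all_momentsD; [exact: all_moments_cst|exact: ama].
have := hermite_average c e s (2 * k); rewrite ce -/H /weighted.
under eq_Rintegral do rewrite powRr0 mul1r horner_comp hornerD hornerC hornerZ hornerX.
by move=> ->; rewrite normrM powRM//; ring.
Qed.

End gaussian_vector.

(** * Mixed moments up to order four *)

Section moments.
Context {R : realType} (n : nat).
Local Notation P := (@unif01 R).
Local Notation gauss := (@gauss R).
Variables (g : 'I_n -> R -> R) (gg : gaussian_vector g).
Notation vec t := (g^~ t).
Implicit Types x y : 'I_n -> R.

Let norm x := Num.sqrt (dot x x).
Let proj x y := dot x y ^+ 2 / dot x x.

Lemma all_moments_dot_powR x q : 0 <= q ->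
  all_moments P (fun t => `|dot x (vec t)| `^ q).
Proof. by move=> q0; apply: all_moments_powR => //; exact: all_moments_dot. Qed.

Let aw x q (f : R -> R) : 0 <= q -> all_moments P f ->
  all_moments P (fun t => `|dot x (vec t)| `^ q * f t).
Proof. by move=> q0 af; apply: all_momentsM => //; exact: all_moments_dot_powR. Qed.

Lemma dot_moment0 q x : 0 <= q -> 0 < dot x x ->
  \int[P]_t (`|dot x (vec t)| `^ q) = norm x `^ q * abs_moment q.
Proof.
move=> q0 x0; have := hermite_dot gg 0 x q0 x0.
rewrite hermite_moment0 expr0 mulr1 => <-.
by apply: eq_Rintegral => t _; rewrite muln0 /= hornerC mulr1.
Qed.

Let hermite2E v z : (hermite v 2).[z] = z ^+ 2 - v :> R.
Proof. by rewrite hermiteSS hermite1 hornerD hornerN hornerM hornerZ !hornerX hornerC; ring. Qed.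

Let hermite4E v z : (hermite v 4).[z] = z ^+ 4 - 6 * v * z ^+ 2 + 3 * v ^+ 2 :> R.
Proof.
have := hermite2E v z; rewrite (hermiteSS _ 2) (hermiteSS _ 1) hermite1.
move: (hermite v 2) => p h2.
by rewrite !(hornerD, hornerN, hornerM, hornerZ, hornerX) h2; ring.
Qed.

(** Expand the square in Hermite polynomials and apply [hermite_dot]; the same
    holds for the fourth power below. *)
Lemma dot_moment2 q x y : 0 <= q -> 0 < dot x x ->
  \int[P]_t (`|dot x (vec t)| `^ q * dot y (vec t) ^+ 2) =
  norm x `^ q * abs_moment q * (dot y y + q * proj x y).
Proof.
move=> q0 x0; have ay := all_moments_dot gg y; have ax := all_moments_dot_powR x q0.
have := hermite_dot gg 1 y q0 x0; rewrite muln1 expr1 hermite_moment1//.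
under eq_Rintegral do rewrite hermite2E mulrBr.
rewrite all_moments_RintegralB; [|by apply: aw => //; exact: all_momentsX|
  by apply: aw => //; exact: all_moments_cst].
under [X in _ - X = _ -> _]eq_Rintegral do rewrite mulrC.
rewrite all_moments_RintegralZl// dot_moment0//.
move=> /eqP; rewrite subr_eq => /eqP ->; rewrite -/(norm x) -/(proj x y); ring.
Qed.

Lemma dot_moment4 x y : 0 < dot x x ->
  \int[P]_t (`|dot x (vec t)| `^ 1 * dot y (vec t) ^+ 4) =
  norm x `^ 1 * abs_moment 1 *
  (3 * dot y y ^+ 2 + 6 * dot y y * proj x y - proj x y ^+ 2).
Proof.
move=> x0; have q0 : 0 <= 1 :> R by [].
have ay := all_moments_dot gg y; have ax := all_moments_dot_powR x q0.
have := hermite_dot gg 2 y q0 x0; rewrite hermite_moment2.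
under eq_Rintegral do rewrite hermite4E mulrDr mulrBr (mulrCA _ (6 * _)) (mulrC _ (3 * _)).
have a4 := aw x q0 (all_momentsX 4 ay); have a2 := aw x q0 (all_momentsX 2 ay).
rewrite all_moments_RintegralD; first last.
- by apply: all_momentsM => //; exact: all_moments_cst.
- have := all_momentsD a4 (all_momentsM (all_moments_cst P (- (6 * dot y y))) a2).
  by under eq_fun do rewrite mulNr.
rewrite all_moments_RintegralB//; last first.
  by apply: all_momentsM => //; exact: all_moments_cst.
rewrite !all_moments_RintegralZl// dot_moment0// dot_moment2//.
move=> /eqP; rewrite -subr_eq0 => /eqP h.
apply/eqP; rewrite -subr_eq0 -h; apply/eqP.
rewrite -/(norm x) -/(proj x y); ring.
Qed.

Let u x i := x i ^+ 2 / dot x x.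

(** Polarisation of [dot_moment4]: twelve times the product of two squares is the
    sum of the fourth powers of [y + z] and [y - z] minus twice those of [y] and
    [z]. *)
Lemma dot_moment22 x i j : 0 < dot x x ->
  \int[P]_t (`|dot x (vec t)| `^ 1 * (g i t ^+ 2 * g j t ^+ 2)) =
  norm x `^ 1 * abs_moment 1 *
  (1 + u x i + u x j - u x i * u x j + (i == j)%:R * (2 + 4 * u x i)).
Proof.
move=> x0; have q0 : 0 <= 1 :> R by [].
have x1 : dot x x != 0 by rewrite gt_eqF.
have dxb k : dot x (unitvec k) = x k by rewrite dotC dot_unitvec.
have dbb k l : dot (unitvec k) (unitvec l) = (k == l)%:R :> R by rewrite dot_unitvec.
have D4 k := dot_moment4 (unitvec k) x0.
have [<-{j}|ij] := eqVneq i j.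
  have := D4 i; rewrite dbb eqxx /proj dxb => h.
  under eq_Rintegral do rewrite -exprD -(dot_unitvec i (g^~ _)).
  rewrite h !mulr1n /u; move: (norm x `^ 1) (abs_moment 1) (dot x x) x1 => a b d d0.
  by field.
pose yp k := unitvec i k + unitvec j k : R; pose ym k := unitvec i k - unitvec j k : R.
have ap := aw x q0 (all_momentsX 4 (all_moments_dot gg yp)).
have am := aw x q0 (all_momentsX 4 (all_moments_dot gg ym)).
have ai := aw x q0 (all_momentsX 4 (all_moments_dot gg (unitvec i))).
have aj := aw x q0 (all_momentsX 4 (all_moments_dot gg (unitvec j))).
have ac := all_moments_cst P.
transitivity (\int[P]_t (12^-1 * (`|dot x (vec t)| `^ 1 * dot yp (vec t) ^+ 4 +
   `|dot x (vec t)| `^ 1 * dot ym (vec t) ^+ 4 +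
   -2 * (`|dot x (vec t)| `^ 1 * dot (unitvec i) (vec t) ^+ 4 +
    `|dot x (vec t)| `^ 1 * dot (unitvec j) (vec t) ^+ 4)))).
  by apply: eq_Rintegral => t _; rewrite /yp /ym dotDl dotBl !dot_unitvec; field.
rewrite all_moments_RintegralZl; last first.
  by apply: all_momentsD; [exact: all_momentsD|apply: all_momentsM => //; exact: all_momentsD].
rewrite all_moments_RintegralD; [|exact: all_momentsD|
  by apply: all_momentsM => //; exact: all_momentsD].
rewrite all_moments_RintegralZl; last exact: all_momentsD.
rewrite !all_moments_RintegralD// !D4 !dot_moment4//.
have vp : dot yp yp = 2.
  by rewrite /yp dotDl !(dotC _ (fun k => _ + _)) !dotDl !dbb !eqxx (negbTE ij) eq_sym (negbTE ij) /=; ring.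
have vm : dot ym ym = 2.
  by rewrite /ym dotBl !(dotC _ (fun k => _ - _)) !dotBl !dbb !eqxx (negbTE ij) eq_sym (negbTE ij) /=; ring.
have pp : dot x yp = x i + x j by rewrite dotC dotDl !dot_unitvec.
have pm : dot x ym = x i - x j by rewrite dotC dotBl !dot_unitvec.
rewrite /proj vp vm pp pm !dxb !dbb !eqxx /u /=.
move: (norm x `^ 1) (abs_moment 1) (dot x x) x1 => a b d d0.
by field.
Qed.

Lemma sum_u x : 0 < dot x x -> \sum_i u x i = 1.
Proof. by move=> x0; rewrite -mulr_suml divff// gt_eqF. Qed.

Let dot_self t : dot (vec t) (vec t) = \sum_i g i t ^+ 2.
Proof. by []. Qed.

Lemma dot_norm_moment2 x l : 0 < dot x x ->
  \int[P]_t (`|dot x (vec t)| `^ 1 * (dot (vec t) (vec t) * g l t ^+ 2)) =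
  norm x `^ 1 * abs_moment 1 * ((n%:R + 3) * (1 + u x l)).
Proof.
move=> x0; have q0 : 0 <= 1 :> R by [].
have ag := all_moments_coord gg.
under eq_Rintegral do rewrite dot_self mulr_suml mulr_sumr.
rewrite all_moments_Rintegral_sum; last first.
  by move=> i; apply: aw => //; apply: all_momentsM; exact: all_momentsX.
under eq_bigr do rewrite dot_moment22//.
rewrite -mulr_sumr; congr (_ * _).
rewrite big_split /= (bigD1 l (P := xpredT) (F := fun i => (i == l)%:R * _))//= eqxx mul1r.
rewrite [X in _ + (_ + X)]big1 ?addr0; last by move=> i /negbTE ->; rewrite mul0r.
transitivity (\sum_(i < n) (1 + u x l) + (1 - u x l) * \sum_i u x i + (2 + 4 * u x l)).
  by congr (_ + _); rewrite mulr_sumr -big_split/=; apply: eq_bigr => i _; ring.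
by rewrite sum_u// sumr_const card_ord -mulr_natl; ring.
Qed.

Lemma dot_norm_moment4 x : 0 < dot x x ->
  \int[P]_t (`|dot x (vec t)| `^ 1 * dot (vec t) (vec t) ^+ 2) =
  norm x `^ 1 * abs_moment 1 * ((n%:R + 1) * (n%:R + 3)).
Proof.
move=> x0; have q0 : 0 <= 1 :> R by [].
have ag := all_moments_coord gg.
have ad : all_moments P (fun t => dot (vec t) (vec t)).
  by apply: all_moments_sum => i; exact: all_momentsM.
under eq_Rintegral do rewrite expr2 {2}dot_self mulr_sumr mulr_sumr.
rewrite all_moments_Rintegral_sum; last first.
  by move=> i; apply: aw => //; apply: all_momentsM => //; exact: all_momentsX.
under eq_bigr do rewrite dot_norm_moment2//.
rewrite -!mulr_sumr big_split /= sum_u// sumr_const card_ord; ring.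
Qed.

End moments.

(** * The embedding for exponent one half *)

Section norm.
Context {R : realType} (m : nat).
Implicit Types x : 'rV[R]_m.+1.

Let vec x i := x 0 i.

Lemma dot_vec_gt0 x : x != 0 -> 0 < dot (vec x) (vec x).
Proof.
move=> x0; rewrite lt_def dot_ge0 andbT; apply: contra x0.
rewrite psumr_eq0; last by move=> i _; exact: sqr_ge0.
move=> /allP h; apply/eqP/rowP => i; rewrite mxE; apply/eqP.
by have := h i (mem_index_enum i); rewrite /= -expr2 sqrf_eq0.
Qed.

Lemma calNE lam x : x != 0 ->
  calN lam x = Num.sqrt (dot (vec x) (vec x)) *
    (1 + lam * (1 - 3 * (x 0 ord_max ^+ 2 / dot (vec x) (vec x)))) ^+ 2.
Proof.
move=> x0; have d0 : dot (vec x) (vec x) != 0 by rewrite gt_eqF// dot_vec_gt0.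
rewrite /calN (negbTE x0) -[\sum_(i < m.+1) x 0 i ^+ 2]/(dot (vec x) (vec x)).
congr (_ * (1 + lam * _) ^+ 2).
have -> : \sum_(i < m.+1 | i.+1 == m.+1 :> nat) x 0 i ^+ 2 = x 0 ord_max ^+ 2.
  by rewrite (big_pred1 ord_max)// => i /=; rewrite eqSS -val_eqE.
have -> : \sum_(i < m.+1 | (i.+1 < m.+1)%N) x 0 i ^+ 2 =
    dot (vec x) (vec x) - x 0 ord_max ^+ 2.
  rewrite /dot [in RHS](bigD1 ord_max)//= addrAC subrr add0r.
  by apply: eq_bigl => i /=; rewrite -val_eqE /= ltnS ltn_neqAle leq_ord andbT.
by move: (dot _ _) d0 => d d0; field.
Qed.

End norm.

Section embedding.
Context {R : realType} (m : nat) (lam : R).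
Hypothesis lam_ge0 : 0 <= lam.
Hypothesis lam_le : lam <= (6 * m.+1%:R - 4)^-1.
Local Notation P := (@unif01 R).
Local Notation N := m.+1%:R.

(** The choice of [a] makes [sum_i weight i (1 + u_i / 2)] equal to
    [1 + lam - 3 lam u] when the [u_i] sum to 1 and the last of them is [u]. *)
Let a : R := (1 + 7 * lam) / (N + 2^-1).
Let weight (i : 'I_m.+1) : R := a - (i == ord_max)%:R * (6 * lam).

Let N_ge1 : 1 <= N :> R. Proof. by rewrite ler1n. Qed.

(** At the last index this is where the upper bound on [lam] enters. *)
Let weight_ge0 i : 0 <= weight i.
Proof.
have N1 := N_ge1; have D0 : 0 < N + 2^-1 :> R by lra.
have E0 : 0 < 6 * N - 4 :> R by lra.
have l1 : lam * (6 * N - 4) <= 1 by rewrite -(ler_pdivlMr _ _ E0) div1r.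
rewrite /weight subr_ge0 /a ler_pdivlMr//; case: (i == ord_max) => /=; move: l1 lam_ge0; move: (N : R) => M; lra.
Qed.

Let half_ge0 : 0 <= 2^-1 :> R. Proof. by []. Qed.

(** The square of the weight [W] enters [T], so that the square root of [|T x|] is
    [W] times that of [|<x, g>|], with an integral given by [dot_moment2]. *)
Theorem embeds_in_L_half : isometric_to_subspace_of_L (2^-1 : R) (@calN R m.+1 lam).
Proof.
have [g gg] := @gaussian_vector_exists R m.+1.
pose A : R := abs_moment 2^-1.
have A0 : 0 < A by apply: abs_moment_gt0 => //; lra.
pose vec (x : 'rV[R]_m.+1) i := x 0 i.
pose W t := A^-1 * \sum_i weight i * g i t ^+ 2.
pose T (x : 'rV[R]_m.+1) (t : measurableTypeR R) : R := W t ^+ 2 * dot (vec x) (g^~ t).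
have W0 t : 0 <= W t.
  rewrite mulr_ge0 ?invr_ge0 ?(ltW A0)//; apply: sumr_ge0 => i _.
  by rewrite mulr_ge0 ?sqr_ge0.
have aW : all_moments P W.
  apply: all_momentsM; first exact: all_moments_cst.
  apply: all_moments_sum => i; apply: all_momentsM; first exact: all_moments_cst.
  by apply: all_momentsX; exact: all_moments_coord.
have aT x : all_moments P (T x).
  by apply: all_momentsM; [exact: all_momentsX|exact: all_moments_dot].
have TE x t : `|T x t| `^ 2^-1 = `|dot (vec x) (g^~ t)| `^ 2^-1 * W t.
  rewrite normrM ger0_norm ?sqr_ge0// powRM ?sqr_ge0// mulrC; congr (_ * _).
  by rewrite powR12_sqrt ?sqr_ge0// sqrtr_sqr ger0_norm.
have integralT x : \int[P]_t (`|T x t| `^ 2^-1) = Num.sqrt (calN lam x).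
  have [->|x0] := eqVneq x 0.
    rewrite /calN eqxx sqrtr0 -[RHS](probability_Rintegral_cst P).
    apply: eq_Rintegral => t _; rewrite /T /dot big1; last by move=> i _; rewrite /vec mxE mul0r.
    by rewrite mulr0 normr0 powR0.
  have d0 := dot_vec_gt0 x0; set r := Num.sqrt (dot (vec x) (vec x)).
  have N1 := N_ge1; have N0 : N + 2^-1 != 0 :> R by rewrite gt_eqF//; lra.
  have aw i : all_moments P (fun t => `|dot (vec x) (g^~ t)| `^ 2^-1 * g i t ^+ 2).
    by apply: all_momentsM; [exact: all_moments_dot_powR|apply: all_momentsX; exact: all_moments_coord].
  under eq_Rintegral do rewrite TE /W mulrCA mulr_sumr.
  rewrite all_moments_RintegralZl; last first.
    apply: all_moments_sum => i; have := all_momentsM (all_moments_cst P (weight i)) (aw i).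
    by under eq_fun do rewrite mulrCA.
  rewrite all_moments_Rintegral_sum; last first.
    move=> i; have := all_momentsM (all_moments_cst P (weight i)) (aw i).
    by under eq_fun do rewrite mulrCA.
  have -> : calN lam x = r *
      (1 + lam * (1 - 3 * (x 0 ord_max ^+ 2 / dot (vec x) (vec x)))) ^+ 2.
    exact: calNE.
  pose u i := x 0 i ^+ 2 / dot (vec x) (vec x).
  have u01 : 0 <= u ord_max <= 1.
    rewrite divr_ge0 ?sqr_ge0 ?(ltW d0)//= ler_pdivrMr// mul1r.
    by rewrite [leRHS](bigD1 ord_max)//= lerDl; apply: sumr_ge0 => i _; exact: sqr_ge0.
  have lam1 : lam <= 2^-1.
    by apply: le_trans lam_le _; rewrite lef_pV2 ?posrE//; lra.
  rewrite sqrtrM ?sqrtr_ge0// sqrtr_sqr ger0_norm; last first.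
    move: u01; rewrite -/(u ord_max) => /andP[]; move: (u ord_max) => v v0 v1.
    have : 0 <= lam * (1 - v) by rewrite mulr_ge0// subr_ge0.
    by move: lam1 lam_ge0; lra.
  rewrite -/(u ord_max).
  transitivity (A^-1 * \sum_i (r `^ 2^-1 * A * (weight i * (1 + 2^-1 * u i)))).
    congr (_ * _); apply: eq_bigr => i _.
    under eq_Rintegral do rewrite mulrCA.
    rewrite all_moments_RintegralZl//.
    have := dot_moment2 gg (unitvec i) half_ge0 d0.
    under eq_Rintegral do rewrite dot_unitvec.
    have dvi : dot (vec x) (unitvec i) = x 0 i by rewrite dotC dot_unitvec.
    have dii : dot (unitvec i) (unitvec i) = 1 :> R by rewrite dot_unitvec /unitvec eqxx.
    by move=> ->; rewrite dvi dii -/(u i) -/r -/A; ring.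
  rewrite -mulr_sumr [r `^ _ * A]mulrC -mulrA mulKf ?gt_eqF// powR12_sqrt ?sqrtr_ge0//.
  congr (_ * _).
  have sumu : \sum_i u i = 1 by rewrite -mulr_suml divff// gt_eqF.
  transitivity (\sum_(i < m.+1) a + a / 2 * \sum_i u i -
    \sum_(i < m.+1) (i == ord_max)%:R * (6 * lam * (1 + 2^-1 * u i))).
    by rewrite mulr_sumr -big_split -sumrB /=; apply: eq_bigr => i _; rewrite /weight; field.
  rewrite sumu [X in _ - X](bigD1 ord_max)//= eqxx [X in _ - (_ + X)]big1; last first.
    by move=> i /negbTE ->; rewrite mul0r.
  rewrite sumr_const card_ord -[_ *+ m.+1]mulr_natl /a /=.
  by move: (u ord_max) (N : R) N1 => v M M1; field; rewrite gt_eqF//; lra.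
have normT x : ('N[lebesgue01 R]_(2^-1)%:E[EFin \o T x] = (calN lam x)%:E)%E.
  have S0 : 0 <= calN lam x.
    rewrite /calN; case: ifP => // _; by rewrite mulr_ge0 ?sqrtr_ge0 ?sqr_ge0.
  rewrite unlock /=.
  rewrite (_ : \int[_]_x0 _ = (Num.sqrt (calN lam x))%:E)%E.
    by rewrite poweR_EFin invrK -[2]/(2%:R) powR_mulrn ?sqrtr_ge0// sqr_sqrtr.
  rewrite -integralT -all_moments_RintegralE; last exact: all_moments_powR.
  by apply: eq_integral.
exists T; split => //.
- move=> x; apply/andP; split; rewrite inE; first exact: (proj1 (aT x)).
  by have := ltry (calN lam x); rewrite -normT.
- move=> b x y; apply/nearW => t _; rewrite /T mulrCA -mulrDr; congr (_ * _).
  rewrite /dot mulr_sumr -big_split/=; apply: eq_bigr => i _.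
  by rewrite /vec !mxE; ring.
Qed.

End embedding.

(** * Concentration of zonal moments at the pole *)

Section concentration.
Context {R : realType} (n : nat).
Local Notation P := (@unif01 R).
Local Notation gauss := (@gauss R).
Variables (g : 'I_n -> R -> R) (gg : gaussian_vector g) (l : 'I_n).
Notation vec t := (g^~ t).

Let v t := g l t ^+ 2 / dot (vec t) (vec t).
Let r t := Num.sqrt (dot (vec t) (vec t)).

Lemma cos2_itv (x : 'I_n -> R) : 0 <= x l ^+ 2 / dot x x <= 1.
Proof.
rewrite divr_ge0 ?sqr_ge0 ?dot_ge0//=.
have [->|d0] := eqVneq (dot x x) 0; first by rewrite invr0 mulr0 ler01.
rewrite ler_pdivrMr ?lt_def ?d0 ?dot_ge0// mul1r.
by rewrite [leRHS](bigD1 l)//= lerDl; apply: sumr_ge0 => i _; exact: sqr_ge0.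
Qed.

Lemma all_moments_self_dot : all_moments P (fun t => dot (vec t) (vec t)).
Proof. by apply: all_moments_sum => i; apply: all_momentsM; exact: all_moments_coord. Qed.

Lemma all_moments_radius : all_moments P (fun t => Num.sqrt (dot (vec t) (vec t))).
Proof.
have := all_moments_powR (q := 2^-1) _ all_moments_self_dot.
rewrite invr_ge0 => /(_ (ler0n _ _)).
by under eq_fun do rewrite powR12_sqrt// ger0_norm ?dot_ge0//.
Qed.

Lemma all_moments_cos2 : all_moments P (fun t => g l t ^+ 2 / dot (vec t) (vec t)).
Proof.
apply: (@all_moments_le _ _ _ _ _ (fun=> 1)); last exact: all_moments_cst.
  apply: measurable_funM; first by apply: measurable_funX; exact: (proj1 gg).
  have := measurableT_comp (measurable_powR (-1)) (proj1 all_moments_self_dot).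
  congr (measurable_fun _ _); apply/funext => t /=.
  by rewrite powR_inv1 ?dot_ge0.
by move=> t; have /andP[v0 v1] := cos2_itv (vec t); rewrite ger0_norm.
Qed.

(** The fifth power of the radius is the product of a quartic form and of a norm. *)
Definition zonal_moment k := \int[P]_t (r t ^+ 5 * v t ^+ k).

Lemma all_moments_zonal k : all_moments P (fun t => r t ^+ 5 * v t ^+ k).
Proof.
by apply: all_momentsM; apply: all_momentsX;
  [exact: all_moments_radius|exact: all_moments_cos2].
Qed.

Let tail (a x : R) : R := if a <= `|x| then 1 else 0.

Let measurable_tail a : measurable_fun setT (tail a).
Proof.
rewrite (_ : tail a = \1_[set x | (a <= `|x|)%R]).
  apply: measurable_indic.
  have := @measurable_fun_ler _ _ R setT (fun=> a) (fun x : R => `|x|)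
    (measurable_cst _) (@normr_measurable R setT) measurableT [set true] I.
  by rewrite setTI; congr measurable; apply/seteqP; split => x.
by apply/funext => x; rewrite indicE /tail; case: ifPn => h; [rewrite mem_set|rewrite memNset//; exact/negP].
Qed.

Let tail_le1 a x : `|tail a x| <= 1.
Proof. by rewrite /tail; case: ifPn => _; rewrite ?normr1 ?normr0. Qed.

Let tail_gt0 a : 0 <= a -> 0 < \int[gauss]_s tail a s.
Proof.
move=> a0.
have am : all_moments gauss (tail a).
  apply: (@all_moments_le _ _ _ gauss (tail a) (fun=> 1)).
  - exact: measurable_tail.
  - by move=> s; exact: tail_le1.
  - exact: all_moments_cst.
rewrite -lte_fin -all_moments_RintegralE//.
have pdf0 : 0 < normal_pdf 0 1 (a + 1).
  by rewrite normal_pdfE ?oner_neq0// mulr_gt0 ?expR_gt0// normal_peak_gt0 ?oner_neq0.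
apply: (@lt_le_trans _ _ (normal_pdf 0 1 (a + 1))%:E); first by rewrite lte_fin.
apply: (@le_trans _ _ (gauss `[a, a + 1]%classic)).
  rewrite /gauss /= /normal_prob.
  apply: (@le_trans _ _ (\int[lebesgue_measure]_(x in `[a, (a + 1)%R]) (normal_pdf 0 1 (a + 1))%:E)%E).
    rewrite integral_cst//= lebesgue_measure_itv/= lte_fin ltrDl ltr01.
    by rewrite -EFinB addrAC subrr add0r mule1.
  apply: ge0_le_integral => //.
  - by move=> x _; rewrite lee_fin ltW.
  - by apply: measurable_funTS; apply/measurable_EFinP; exact: measurable_normal_pdf.
  move=> x /=; rewrite in_itv/= => /andP[ax xa].
  rewrite lee_fin normal_pdfE ?oner_neq0// ler_wpM2l ?normal_peak_ge0//.
  rewrite ler_expR !subr0 expr1n !mulNr lerN2 ler_pM2r ?invr_gt0//.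
  by rewrite lerXn2r ?nnegrE//; lra.
have mi : measurable (`[a, a + 1]%classic : set R) by exact: measurable_itv.
have e := integral_indic gauss measurableT mi; rewrite setIT in e.
apply: (@le_trans _ _ (\int[gauss]_x (\1_(`[a, a + 1]%classic : set R) x)%:E)%E).
  by rewrite le_eqVlt; apply/orP; left; apply/eqP; exact: (esym e).
apply: ge0_le_integral => //.
- by apply/measurable_EFinP; exact: measurable_indic.
- by apply/measurable_EFinP; exact: measurable_tail.
move=> x _; rewrite lee_fin indicE /tail.
case: (boolP (x \in _)) => [|_]; last by case: ifPn.
rewrite inE/= in_itv/= => /andP[ax _].
by rewrite (le_trans ax)// ler_norm.
Qed.

Let all_moments_tail d (U : measurableType d) (m : probability U R) (f : U -> R) a :
  measurable_fun setT f -> all_moments m (fun t => tail a (f t)).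
Proof.
move=> mf; apply: (@all_moments_le _ _ _ m _ (fun=> 1)).
- exact: measurableT_comp (measurable_tail a) mf.
- by move=> s; exact: tail_le1.
- exact: all_moments_cst.
Qed.

Let gauss_sqr : \int[gauss]_s (s ^+ 2) = 1.
Proof.
have := @abs_moment_rec R 0 (lexx 0); rewrite abs_moment0 !add0r mulr1 => <-.
by apply: eq_Rintegral => s _; rewrite powR_mulrn// real_normK ?num_real.
Qed.

Let tailM a c s : c ^+ 2 = 1 -> tail a (c * s) = tail a s.
Proof.
move=> /eqP; rewrite sqrf_eq1 => /orP[] /eqP ->; first by rewrite mul1r.
by rewrite /tail mulN1r normrN.
Qed.

(** Distinct coordinates of [g] are independent. *)
Let tail_coord a :
  \int[P]_t tail a (g l t) = \int[gauss]_s tail a s /\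
  forall i, i != l ->
    \int[P]_t (tail a (g l t) * g i t ^+ 2) = \int[gauss]_s tail a s.
Proof.
have m1 : measurable_fun [set: R * R] (fun z : R * R => tail a z.1).
  exact: measurableT_comp (measurable_tail a) measurable_fst.
have dbb k k' : dot (unitvec k) (unitvec k') = (k == k')%:R :> R by rewrite dot_unitvec.
have amt : all_moments gauss (tail a) by apply: all_moments_tail; exact: measurable_id.
have amt1 : all_moments (product_probability gauss gauss) (fun z : R * R => tail a z.1).
  exact: (all_moments_fst gauss amt).
split.
  have [b [c [e [b2 _ _ law]]]] := gaussian_vector_law gg (unitvec l) (unitvec l).
  have := law _ m1; under eq_Rintegral do rewrite dot_unitvec.
  move=> ->; rewrite dbb eqxx in b2.
  under eq_Rintegral do rewrite /= tailM//.
  rewrite all_moments_fubini//=; last by move=> x; exact: all_moments_cst.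
  by apply: eq_Rintegral => s _; exact: (probability_Rintegral_cst gauss).
move=> i il.
have [b [c [e [b2 bc ce law]]]] := gaussian_vector_law gg (unitvec l) (unitvec i).
have m2 : measurable_fun [set: R * R] (fun z : R * R => tail a z.1 * z.2 ^+ 2).
  by apply: measurable_funM => //; apply: measurable_funX; exact: measurable_snd.
have := law _ m2; under eq_Rintegral do rewrite !dot_unitvec.
move=> ->; rewrite dbb eqxx in b2; rewrite dbb eq_sym (negbTE il) in bc.
rewrite dbb eqxx in ce.
have c0 : c = 0.
  move/eqP: bc; rewrite mulf_eq0 => /orP[/eqP b0|/eqP//].
  by move/eqP: b2; rewrite b0 expr0n eq_sym oner_eq0.
have e2 : e ^+ 2 = 1 by rewrite -[RHS]ce c0 expr0n add0r.
have simpl z : tail a (b * z.1) * (c * z.1 + e * z.2) ^+ 2 = tail a z.1 * z.2 ^+ 2.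
  by rewrite tailM// c0 mul0r add0r exprMn e2 mul1r.
under eq_Rintegral do rewrite /= simpl.
have ag := @all_moments_gauss R.
rewrite all_moments_fubini/=; first last.
- by move=> s; apply: all_momentsM; [exact: all_moments_cst|exact: all_momentsX].
- apply: all_momentsM => //; apply: all_momentsX; exact: (all_moments_snd gauss ag).
apply: eq_Rintegral => s _.
by rewrite all_moments_RintegralZl ?gauss_sqr ?mulr1//; exact: all_momentsX.
Qed.

Let zonal_ge0 a b d k : (forall x, 0 <= x -> x <= 1 -> 0 <= a + b * x + d * x ^+ 2) ->
  0 <= a * zonal_moment k + b * zonal_moment k.+1 + d * zonal_moment k.+2.
Proof.
move=> pos; have az := all_moments_zonal.
have azc c j : all_moments P (fun t => c * (r t ^+ 5 * v t ^+ j)).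
  by apply: all_momentsM => //; exact: all_moments_cst.
rewrite /zonal_moment -!all_moments_RintegralZl// -!all_moments_RintegralD//; last first.
  exact: all_momentsD.
apply: Rintegral_ge0 => t _; have /andP[v0 v1] := cos2_itv (vec t).
rewrite (_ : _ + _ + _ = r t ^+ 5 * v t ^+ k * (a + b * v t + d * v t ^+ 2)).
  by rewrite mulr_ge0 ?pos// mulr_ge0// exprn_ge0// sqrtr_ge0.
by rewrite !exprS; ring.
Qed.

(** When [|g l| >= a] and the other coordinates have square sum at most [2 n], the
    squared cosine is at least [rho] and the radius is at least 1.  Given the first
    event, the second has probability at least 1/2 by the inequality of Markov. *)
Let zonal_lower a rho k : 1 <= a -> 0 <= rho -> rho * (a ^+ 2 + 2 * n%:R) <= a ^+ 2 ->
  rho ^+ k * (2^-1 * \int[gauss]_s tail a s) <= zonal_moment k.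
Proof.
move=> a1 rho0 rhoa; set p := \int[gauss]_s _.
have p0 : 0 <= p by rewrite ltW// tail_gt0//; lra.
have n0 : 0 < n%:R :> R by rewrite ltr0n; case: n l => // -[].
have [tl ti] := tail_coord a.
have amt : all_moments P (fun t => tail a (g l t)).
  by apply: all_moments_tail; exact: (proj1 gg).
have ami i : all_moments P (fun t => tail a (g l t) * g i t ^+ 2).
  by apply: all_momentsM => //; apply: all_momentsX; exact: all_moments_coord.
have amis : all_moments P (fun t => \sum_(i | i != l) tail a (g l t) * g i t ^+ 2).
  exact: all_moments_sum.
have amL : all_moments P (fun t => tail a (g l t) -
    (2 * n%:R)^-1 * \sum_(i | i != l) tail a (g l t) * g i t ^+ 2).
  have := all_momentsD amt (all_momentsM (all_moments_cst P (- (2 * n%:R)^-1)) amis).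
  by under eq_fun do rewrite mulNr.
apply: (@le_trans _ _ (\int[P]_t (rho ^+ k * (tail a (g l t) -
    (2 * n%:R)^-1 * \sum_(i | i != l) tail a (g l t) * g i t ^+ 2)))).
  rewrite all_moments_RintegralZl// ler_wpM2l ?exprn_ge0//.
  rewrite all_moments_RintegralB//; last by apply: all_momentsM => //; exact: all_moments_cst.
  rewrite all_moments_RintegralZl// tl -/p.
  have -> : \int[P]_t (\sum_(i | i != l) tail a (g l t) * g i t ^+ 2) =
      \sum_(i | i != l) p.
    under eq_Rintegral do rewrite -big_filter.
    rewrite all_moments_Rintegral_sum// big_filter.
    by apply: eq_bigr => i il; rewrite ti.
  have : \sum_(i | i != l) p <= n%:R * p.
    have -> : n%:R * p = \sum_(i < n) p by rewrite sumr_const card_ord mulr_natl.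
    by rewrite [leRHS](bigD1 l)//= lerDr.
  move=> h; have := ler_wpM2l (_ : 0 <= (2 * n%:R)^-1) h.
  rewrite invr_ge0 mulr_ge0 ?(ltW n0)// => /(_ isT).
  have -> : (2 * n%:R)^-1 * (n%:R * p) = 2^-1 * p by field; rewrite gt_eqF.
  lra.
apply: le_Rintegral => //.
- by apply: all_moments_integrable; apply: all_momentsM => //; exact: all_moments_cst.
- exact/all_moments_integrable/all_moments_zonal.
move=> t _; have /andP[v0 v1] := cos2_itv (vec t).
have W0 : 0 <= r t ^+ 5 * v t ^+ k.
  by rewrite mulr_ge0 ?exprn_ge0// sqrtr_ge0.
rewrite -mulr_sumr; set s2 := \sum_(i | _) _.
have s20 : 0 <= s2 by apply: sumr_ge0 => i _; exact: sqr_ge0.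
have dE : dot (vec t) (vec t) = g l t ^+ 2 + s2 by rewrite /dot (bigD1 l).
rewrite /tail; case: ifPn => ag; last by rewrite mul0r mulr0 subrr mulr0.
rewrite mul1r; have [s2n|s2n] := ltP (2 * n%:R) s2.
  apply: le_trans W0; rewrite mulr_ge0_le0 ?exprn_ge0// subr_le0 mulrC.
  by rewrite ler_pdivlMr ?mul1r ?ltW// mulr_gt0.
have ga : a ^+ 2 <= g l t ^+ 2.
  by rewrite -(real_normK (num_real (g l t))) lerXn2r ?nnegrE//; lra.
have a2 : 1 <= a ^+ 2 by rewrite expr_ge1//; lra.
have d1 : 1 <= dot (vec t) (vec t) by rewrite dE; lra.
have r1 : 1 <= r t by rewrite -sqrtr1 ler_sqrt//; lra.
have rv : rho <= v t.
  rewrite /v ler_pdivlMr ?dE//; last by lra.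
  move: ga s2n rhoa; move: (g l t ^+ 2) => G; nra.
apply: (@le_trans _ _ (rho ^+ k)).
  rewrite ler_piMr ?exprn_ge0// gerBl mulr_ge0// invr_ge0 mulr_ge0// ltW//.
apply: (@le_trans _ _ (v t ^+ k)); first by rewrite lerXn2r.
by rewrite ler_peMl ?exprn_ge0// exprn_ege1.
Qed.

(** If all these combinations were nonnegative, the zonal moments would decay like
    [rho ^+ k] for some [rho < 1], whereas [zonal_lower] bounds them below by a
    multiple of [rho' ^+ k] for any [rho' < 1]. *)
Lemma zonal_concentration A B D : A + B + D < 0 ->
  exists k, A * zonal_moment k + B * zonal_moment k.+1 + D * zonal_moment k.+2 < 0.
Proof.
move=> neg; apply: contrapT => /forallNP H.
pose eps := - (A + B + D); pose C := `|B| + 2 * `|D| + eps + 1.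
have eps0 : 0 < eps by rewrite /eps oppr_gt0.
have B0 := normr_ge0 B; have D0 := normr_ge0 D.
have C0 : 0 < C by rewrite /C; lra.
have step k : C * zonal_moment k.+1 <= (C - eps) * zonal_moment k.
  have /negP := H k; rewrite -leNgt => Hk.
  (* this quadratic polynomial vanishes at 1, and [C] is so large that it is
     nonnegative on the unit interval *)
  have := @zonal_ge0 (C - eps - A) (- C - B) (- D) k; apply: (fun h1 h2 => _ (h2 h1)).
    by lra.
  move=> x x0 x1; have := ler_norm B; have := ler_norm D.
  have := ler_norm (- B); have := ler_norm (- D); rewrite !normrN.
  rewrite /C /eps => d1 b1 d2 b2.
  have h1 : 0 <= (1 - x) * (`|B| + B) by apply: mulr_ge0; lra.
  have h2 : 0 <= (1 - x) * (1 - x) * `|D| by rewrite !mulr_ge0//; lra.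
  have h3 : 0 <= (1 - x) * (1 + x) * (`|D| + D) by rewrite !mulr_ge0//; lra.
  nra.
pose rho := (C - eps) / C.
have rho01 : 0 < rho /\ rho < 1.
  by rewrite /rho divr_gt0 ?ltr_pdivrMr// /C; lra.
case: rho01 => rho0 rho1.
have geom k : zonal_moment k <= rho ^+ k * zonal_moment 0.
  elim: k => [|k IH]; first by rewrite expr0 mul1r.
  have := step k; rewrite -ler_pdivlMl// => /le_trans; apply.
  by rewrite mulrA mulrC -/rho [_^-1 * _]mulrC -/rho exprS -mulrA mulrC ler_wpM2l ?(ltW rho0).
pose rho' := (1 + rho) / 2.
have n0 : 0 <= n%:R :> R by [].
pose a := 1 + 2 * n%:R * rho' / (1 - rho').
have a1 : 1 <= a.
  by rewrite /a lerDl divr_ge0 ?mulr_ge0// /rho'; lra.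
have ha : rho' * (a ^+ 2 + 2 * n%:R) <= a ^+ 2.
  have h1 : 2 * n%:R * rho' <= a * (1 - rho').
    rewrite /a [leRHS]mulrDl divfK ?mul1r; first by rewrite lerDr /rho'; lra.
    by rewrite /rho' gt_eqF//; lra.
  have h2 : a * (1 - rho') <= a ^+ 2 * (1 - rho').
    by rewrite ler_wpM2r ?expr2 ?ler_peMr// /rho'; lra.
  lra.
have p0 := @tail_gt0 a ltac:(lra).
set p := \int[gauss]_s _ in p0.
have rho'0 : 0 < rho' by rewrite /rho'; lra.
have key k : 2^-1 * p <= (rho / rho') ^+ k * zonal_moment 0.
  have := le_trans (@zonal_lower a rho' k a1 (ltW rho'0) ha) (geom k).
  by move=> h; rewrite expr_div_n mulrAC ler_pdivlMr ?exprn_gt0// mulrC.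
have z0 : 0 <= zonal_moment 0.
  apply: Rintegral_ge0 => t _.
  by rewrite mulr_ge0 ?exprn_ge0 ?sqrtr_ge0//; have /andP[] := cos2_itv (vec t).
have z1 : 0 < zonal_moment 0 + 1 by rewrite ltr_wpDl.
have q0 : 0 <= rho / rho' by rewrite divr_ge0// ltW.
have q1 : `|rho / rho'| < 1.
  by rewrite ger0_norm// (ltr_pdivrMr _ _ rho'0) mul1r /rho'; lra.
have e0 : 0 < 2^-1 * p / (zonal_moment 0 + 1) by rewrite divr_gt0// mulr_gt0.
have := cvg_expr q1 => /cvgr0Pnorm_lt/(_ _ e0)[k _ /(_ k (leqnn k)) /=].
rewrite ltr_pdivlMr// => hk; have := key k.
have hq : 0 <= (rho / rho') ^+ k by rewrite exprn_ge0.
move: hk; rewrite ger0_norm// mulrDr mulr1 => hk1 hk2; lra.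
Qed.

End concentration.

(** * Exchange of integrals *)

Section swap.
Context {R : realType} (n : nat).
Local Notation P := (@unif01 R).
Let PP : {measure set (measurableTypeR R * measurableTypeR R) -> \bar R} :=
  product_probability P P.
Variables (f : R * R -> R) (a b : 'I_n -> R -> R).
Hypothesis mf : measurable_fun setT f.
Hypothesis ia : forall i, P.-integrable setT (EFin \o a i).
Hypothesis ib : forall i, P.-integrable setT (EFin \o b i).
Hypothesis fab : forall w t, `|f (w, t)| <= \sum_i a i w * b i t.

Lemma integrable_combination (c : 'I_n -> R) (h : 'I_n -> R -> R) :
  (forall i, P.-integrable setT (EFin \o h i)) ->
  P.-integrable setT (fun t => (\sum_i c i * h i t)%:E).
Proof.
move=> ih.
have := @integrable_sum _ _ R P setT measurableT _ (index_enum 'I_n) xpredT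
  (fun i t => ((c i)%:E * (h i t)%:E)%E) (fun i _ => integrableZl measurableT (c i) (ih i)).
by apply: eq_integrable => // t _; rewrite -sumEFin.
Qed.

Let integrable_left w : P.-integrable setT (fun t => (f (w, t))%:E).
Proof.
apply: le_integrable (integrable_combination (a^~ w) ib) => //.
  by apply/measurable_EFinP; exact: measurableT_comp mf (pair1_measurable w).
by move=> t _; rewrite /= lee_fin (le_trans (fab w t))// ler_norm.
Qed.

Let integrable_right t : P.-integrable setT (fun w => (f (w, t))%:E).
Proof.
apply: le_integrable (integrable_combination (b^~ t) ia) => //.
  by apply/measurable_EFinP; exact: measurableT_comp mf (pair2_measurable t).
move=> w _; rewrite /= lee_fin (le_trans (fab w t))//.
by under eq_bigr do rewrite mulrC; rewrite ler_norm.
Qed.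

Let integrable_prod : PP.-integrable setT (EFin \o f).
Proof.
have mfE : measurable_fun setT (EFin \o f) by exact/measurable_EFinP.
apply/(@integrable12ltyP _ _ (measurableTypeR R) (measurableTypeR R) R P P) => //.
have /integrableP[_] := integrable_combination (fun i => \int[P]_t b i t) ia.
apply: le_lt_trans; apply: ge0_le_integral => //.
- by move=> w _; exact: integral_ge0.
- have mabs : measurable_fun setT (fun z : R * R => `|(f z)%:E|%E).
    exact: measurableT_comp.
  have := @measurable_fun_fubini_tonelli_F _ _ (measurableTypeR R) (measurableTypeR R) R P _ mabs.
  by apply.
- apply: measurableT_comp => //.
  exact: measurable_int (integrable_combination (fun i => \int[P]_t b i t) ia).
move=> w _; apply: (@le_trans _ _ (\int[P]_t (\sum_i a i w * b i t)%:E)%E).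
  apply: ge0_le_integral => //.
  - by apply: measurableT_comp => //; exact: measurable_int (integrable_left w).
  - exact: measurable_int (integrable_combination (a^~ w) ib).
  by move=> t _; rewrite lee_fin.
have -> : (\int[P]_t (\sum_i a i w * b i t)%:E =
   (\sum_i a i w * \int[P]_t b i t)%:E)%E.
  under eq_integral do rewrite -sumEFin.
  rewrite integral_sum//; last by move=> i; exact: (integrableZl measurableT (a i w) (ib i)).
  rewrite -sumEFin; apply: eq_bigr => i _.
  under eq_integral do rewrite EFinM.
  rewrite (integralZl measurableT (ib i)) EFinM; congr (_ * _)%E.
  by rewrite /Rintegral fineK//; exact: integrable_fin_num (ib i).
by rewrite lee_fin; under eq_bigr do rewrite mulrC; exact: ler_norm.
Qed.

(** A domination by finitely many products of integrable functions makes [f]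
    integrable on the square. *)
Lemma Rintegral_swap :
  \int[P]_w \int[P]_t f (w, t) = \int[P]_t \int[P]_w f (w, t).
Proof.
have h := @Fubini _ _ (measurableTypeR R) (measurableTypeR R) R P P _ integrable_prod.
rewrite /Rintegral; congr fine; apply: (etrans _ (etrans h _)).
  by apply: eq_integral => w _; rewrite fineK//; exact: integrable_fin_num (integrable_left w).
by apply: eq_integral => t _; rewrite fineK//; exact: integrable_fin_num (integrable_right t).
Qed.

End swap.

(** * The obstruction for exponent one *)

Section zonal.
Context {R : realType} (n : nat).
Local Notation P := (@unif01 R).
Variable l : 'I_n.

Definition zonal k (y : 'I_n -> R) : R :=
  Num.sqrt (dot y y) * (y l ^+ 2 / dot y y) ^+ k.

Lemma measurable_zonal k (phi : 'I_n -> R -> R) :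
  (forall i, measurable_fun setT (phi i)) ->
  measurable_fun setT (fun t => zonal k (phi^~ t)).
Proof.
move=> mphi.
have md : measurable_fun setT (fun t => dot (phi^~ t) (phi^~ t)).
  by apply: measurable_sum => i; exact: measurable_funM.
apply: measurable_funM.
  have := measurableT_comp (measurable_powR 2^-1) md.
  congr (measurable_fun _ _); apply/funext => t /=.
  by rewrite powR12_sqrt ?dot_ge0.
apply: measurable_funX; apply: measurable_funM; first exact: measurable_funX.
have := measurableT_comp (measurable_powR (-1)) md.
congr (measurable_fun _ _); apply/funext => t /=.
by rewrite powR_inv1 ?dot_ge0.
Qed.

Lemma zonal_ge0 k y : 0 <= zonal k y.
Proof.
by rewrite mulr_ge0 ?sqrtr_ge0// exprn_ge0//; have /andP[] := cos2_itv l y.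
Qed.

Lemma zonal_le k y : `|zonal k y| <= \sum_i `|y i|.
Proof.
have /andP[v0 v1] := cos2_itv l y.
rewrite ger0_norm ?zonal_ge0//; apply: (@le_trans _ _ (Num.sqrt (dot y y))).
  by rewrite ler_piMr ?sqrtr_ge0// exprn_ile1.
have S0 : 0 <= \sum_i `|y i| by exact: sumr_ge0.
rewrite -(ger0_norm S0) -sqrtr_sqr ler_sqrt ?sqr_ge0// expr2 mulr_suml.
apply: ler_sum => i _; rewrite -expr2 -real_normK ?num_real// expr2 ler_wpM2l//.
by rewrite [leRHS](bigD1 i)//= lerDl; exact: sumr_ge0.
Qed.

Variables (g : 'I_n -> R -> R) (gg : gaussian_vector g).

Let H k t := (hermite (1 : R) (2 * k)).[g l t].

Let all_moments_H k : all_moments P (H k).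
Proof. by apply: all_moments_horner; exact: all_moments_coord. Qed.

(** Whatever the random vector [phi] and the signed weight [rho], testing the
    function that they represent against a Hermite polynomial turns the kernel
    [|<x, y>|] into a zonal function of [y], by [hermite_dot] under the integral. *)
Lemma hermite_test k (rho : R -> R) (phi : 'I_n -> R -> R) :
  measurable_fun setT rho -> (forall i, measurable_fun setT (phi i)) ->
  (forall i, P.-integrable setT (EFin \o (fun t => `|rho t| * `|phi i t|))) ->
  \int[P]_w (H k w * \int[P]_t (rho t * `|dot (g^~ w) (phi^~ t)|)) =
  hermite_moment 1 k * \int[P]_t (rho t * zonal k (phi^~ t)).
Proof.
move=> mrho mphi iphi.
have ag := all_moments_coord gg; have aH := all_moments_H k.
pose f (z : R * R) := H k z.1 * (rho z.2 * `|dot (g^~ z.1) (phi^~ z.2)|).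
have mdot : measurable_fun setT (fun z : R * R => `|dot (g^~ z.1) (phi^~ z.2)|).
  apply: measurableT_comp => //; apply: measurable_sum => i.
  apply: measurable_funM; first exact: measurableT_comp (proj1 (ag i)) measurable_fst.
  exact: measurableT_comp (mphi i) measurable_snd.
have mf : measurable_fun setT f.
  apply: measurable_funM; first exact: measurableT_comp (proj1 aH) measurable_fst.
  by apply: measurable_funM => //; exact: measurableT_comp mrho measurable_snd.
pose a i w := `|H k w * g i w|.
pose b i t := `|rho t| * `|phi i t|.
have dot_le w t : `|rho t * `|dot (g^~ w) (phi^~ t)| | <= \sum_i `|g i w| * b i t.
  rewrite normrM normr_id; apply: (@le_trans _ _ (`|rho t| * \sum_i `|g i w * phi i t|)).
    by rewrite ler_wpM2l//; exact: ler_norm_sum.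
  by rewrite mulr_sumr; apply: ler_sum => i _; rewrite normrM /b mulrCA.
have fab w t : `|f (w, t)| <= \sum_i a i w * b i t.
  rewrite /f /= normrM; apply: (le_trans (ler_wpM2l _ (dot_le w t))) => //.
  by rewrite mulr_sumr; apply: ler_sum => i _; rewrite /a normrM mulrA.
transitivity (\int[P]_w \int[P]_t f (w, t)).
  apply: eq_Rintegral => w _; rewrite /f /= RintegralZl//.
  apply: le_integrable (integrable_combination (fun i => `|g i w|) iphi) => //.
    apply/measurable_EFinP; apply: measurable_funM => //.
    exact: measurableT_comp mdot (pair1_measurable w).
  by move=> t _; rewrite /= lee_fin (le_trans (dot_le w t))// ler_norm.
rewrite (Rintegral_swap mf _ iphi fab); last first.
  by move=> i; apply: all_moments_integrable; apply: all_moments_norm; exact: all_momentsM.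
have inner t : \int[P]_w f (w, t) = hermite_moment 1 k * (rho t * zonal k (phi^~ t)).
  rewrite /f /=; set y := phi^~ t.
  have ay := all_moments_dot_powR gg y (ler01 : 0 <= 1 :> R).
  transitivity (rho t * \int[P]_w (`|dot y (g^~ w)| `^ 1 * H k w)).
    rewrite -all_moments_RintegralZl; last exact: all_momentsM.
    by apply: eq_Rintegral => w _; rewrite powRr1// (dotC y); ring.
  have [d0|d0] := eqVneq (dot y y) 0.
    rewrite /zonal d0 sqrtr0 mul0r !mulr0 -[RHS](mulr0 (rho t)); congr (_ * _).
    rewrite -[RHS](probability_Rintegral_cst P); apply: eq_Rintegral => w _.
    have y0 i : y i = 0.
      apply/eqP; rewrite -sqrf_eq0; apply/eqP.
      move/eqP: d0; rewrite psumr_eq0; last by move=> j _; exact: sqr_ge0.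
      by move=> /allP/(_ i (mem_index_enum i))/eqP.
    by rewrite powRr1// /dot big1 ?normr0 ?mul0r// => i _; rewrite y0 mul0r.
  have dgt : 0 < dot y y by rewrite lt_def d0 dot_ge0.
  have := hermite_dot gg k (unitvec l) (ler01 : 0 <= 1 :> R) dgt.
  rewrite (dot_unitvec l (unitvec l)) /unitvec eqxx -/(unitvec l) (dotC y) dot_unitvec.
  under eq_Rintegral do rewrite dot_unitvec.
  by move=> ->; rewrite powRr1 ?sqrtr_ge0// /zonal; ring.
under eq_Rintegral do rewrite inner.
rewrite RintegralZl//.
apply: le_integrable (integrable_combination (fun=> 1) iphi) => //.
  by apply/measurable_EFinP; apply: measurable_funM => //; exact: measurable_zonal.
move=> t _; rewrite /= lee_fin normrM.
apply: le_trans (ler_norm _); under eq_bigr do rewrite mul1r.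
by rewrite -mulr_sumr ler_wpM2l// zonal_le.
Qed.

End zonal.

Section obstruction.
Context {R : realType} (m : nat) (lam : R).
Local Notation P := (@unif01 R).
Local Notation N := (m.+1%:R : R).
Local Notation l := (ord_max : 'I_m.+1).

Let c : R := abs_moment 1.
Let c_gt0 : 0 < c. Proof. by apply: abs_moment_gt0; lra. Qed.
Let N_gt0 : 0 < N. Proof. by rewrite ltr0n. Qed.

(** By [dot_moment4], [dot_norm_moment2] and [dot_norm_moment4], integrating a
    quartic form times [|<x, g>|] gives [|x|] times a quadratic polynomial in [u].
    The coefficients below make it [(1 + lam - 3 lam u)^2]: [D] is forced by [u^2],
    then [B] by [u], then [A] by the constant term. *)
Let D : R := - (9 * lam ^+ 2) / c.
Let B : R := (54 * lam ^+ 2 - 6 * lam * (1 + lam)) / (c * (N + 3)).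
Let A : R := ((1 + lam) ^+ 2 + 27 * lam ^+ 2 - (54 * lam ^+ 2 - 6 * lam * (1 + lam)))
             / (c * ((N + 1) * (N + 3))).

Let density (y : 'I_m.+1 -> R) : R :=
  A * dot y y ^+ 2 + B * (dot y y * y l ^+ 2) + D * y l ^+ 4.

Let density_pole : A + B + D =
  (1 - (6 * N - 2) * lam - (9 * N ^+ 2 - 12 * N - 1) * lam ^+ 2)
  / (c * ((N + 1) * (N + 3))).
Proof.
rewrite /A /B /D; move: c c_gt0 N N_gt0 => c' c0 N' N0.
by field; rewrite ?gt_eqF//; lra.
Qed.

Section gaussian.
Variables (g : 'I_m.+1 -> R -> R) (gg : gaussian_vector g).

Let all_moments_density : all_moments P (fun t => density (g^~ t)).
Proof.
have ag := all_moments_coord gg; have ad := all_moments_self_dot gg.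
have ac := all_moments_cst P.
by apply: all_momentsD; [apply: all_momentsD|]; apply: all_momentsM => //;
  [apply: all_momentsX|apply: all_momentsM => //; apply: all_momentsX|apply: all_momentsX].
Qed.

Let calN_cosine_transform (x : 'rV[R]_m.+1) :
  calN lam x = \int[P]_t (density (g^~ t) * `|dot (fun i => x 0 i) (g^~ t)|).
Proof.
have [->|x0] := eqVneq x 0.
  rewrite /calN eqxx -[LHS](probability_Rintegral_cst P).
  apply: eq_Rintegral => t _; rewrite /dot big1; last by move=> i _; rewrite mxE mul0r.
  by rewrite normr0 mulr0.
have d0 := dot_vec_gt0 x0; set y := fun i => x 0 i in d0 *.
have ay := all_moments_dot_powR gg y (ler01 : 0 <= 1 :> R).
have ag := all_moments_coord gg; have ad := all_moments_self_dot gg.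
have ac := all_moments_cst P.
transitivity (\int[P]_t (A * (`|dot y (g^~ t)| `^ 1 * dot (g^~ t) (g^~ t) ^+ 2) +
  B * (`|dot y (g^~ t)| `^ 1 * (dot (g^~ t) (g^~ t) * g l t ^+ 2)) +
  D * (`|dot y (g^~ t)| `^ 1 * dot (unitvec l) (g^~ t) ^+ 4))); last first.
  by apply: eq_Rintegral => t _; rewrite powRr1// dot_unitvec /density; ring.
have a1 : all_moments P (fun t => `|dot y (g^~ t)| `^ 1 * dot (g^~ t) (g^~ t) ^+ 2).
  by apply: all_momentsM => //; exact: all_momentsX.
have a2 : all_moments P (fun t => `|dot y (g^~ t)| `^ 1 * (dot (g^~ t) (g^~ t) * g l t ^+ 2)).
  by apply: all_momentsM => //; apply: all_momentsM => //; exact: all_momentsX.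
have a3 : all_moments P (fun t => `|dot y (g^~ t)| `^ 1 * dot (unitvec l) (g^~ t) ^+ 4).
  by apply: all_momentsM => //; apply: all_momentsX; exact: all_moments_dot.
have aZ f k : all_moments P f -> all_moments P (fun t => k * f t) by exact: all_momentsM.
rewrite !all_moments_RintegralD ?all_moments_RintegralZl//;
  try by [exact: aZ|apply: all_momentsD; exact: aZ].
rewrite (dot_norm_moment4 gg)// (dot_norm_moment2 gg)// (dot_moment4 gg)// calNE//.
have yl : dot y (unitvec l) = x 0 l by rewrite dotC dot_unitvec.
have ll : dot (unitvec l) (unitvec l) = 1 :> R by rewrite dot_unitvec /unitvec eqxx.
rewrite yl ll powRr1 ?sqrtr_ge0// -/c -/y.
rewrite /A /B /D; move: c c_gt0 N N_gt0 => c' c0 N' N0.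
rewrite -[y ord_max]/(x 0 ord_max).
move: (Num.sqrt (dot y y)) (dot y y) d0 => r d d0.
by field; rewrite ?gt_eqF//; lra.
Qed.

(** The signed quartic weight on [g] and the weight 1 on [xi] represent the same
    norm, hence have the same zonal integrals; those of the weight 1 are
    nonnegative. *)
Lemma test_against_representation k (xi : 'I_m.+1 -> R -> R) :
  (forall i, measurable_fun setT (xi i)) ->
  (forall i, P.-integrable setT (EFin \o xi i)) ->
  (forall x : 'rV[R]_m.+1, calN lam x = \int[P]_t `|dot (fun i => x 0 i) (xi^~ t)|) ->
  0 <= A * zonal_moment g l k + B * zonal_moment g l k.+1 + D * zonal_moment g l k.+2.
Proof.
move=> mxi ixi xiE.
have rowE w : (fun i => (\row_i0 g i0 w) 0 i) = g^~ w.
  by apply/funext => i; rewrite mxE.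
have t1 := hermite_test l gg k (measurable_cst (1 : R)) mxi.
have t2 := hermite_test l gg k (proj1 all_moments_density) (proj1 gg).
have /t1 {}t1 : forall i, P.-integrable setT (EFin \o (fun t => `|1 : R| * `|xi i t|)).
  move=> i; apply: le_integrable (ixi i) => //.
    apply/measurable_EFinP; apply: measurable_funM => //.
    exact: measurableT_comp (@normr_measurable R setT) (mxi i).
  by move=> t _; rewrite /= normr1 mul1r normr_id lexx.
have /t2 {}t2 : forall i, P.-integrable setT
    (EFin \o (fun t => `|density (g^~ t)| * `|g i t|)).
  move=> i; apply: all_moments_integrable.
  by apply: all_momentsM; apply: all_moments_norm => //; exact: all_moments_coord.
have tt : \int[P]_t (1 * zonal l k (xi^~ t)) = \int[P]_t (density (g^~ t) * zonal l k (g^~ t)).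
  apply: (mulfI (hermite_moment_neq0 k)); rewrite -t1 -t2.
  apply: eq_Rintegral => w _; congr (_ * _).
  have := calN_cosine_transform (\row_i g i w); rewrite rowE.
  have := xiE (\row_i g i w); rewrite rowE => -> h; apply: (etrans _ (etrans h _)).
    by apply: eq_Rintegral => t _; rewrite mul1r.
  by apply: eq_Rintegral => t _; rewrite dotC.
have : 0 <= \int[P]_t (density (g^~ t) * zonal l k (g^~ t)).
  by rewrite -tt; apply: Rintegral_ge0 => t _; rewrite mul1r zonal_ge0.
have az := all_moments_zonal gg l.
have aZ f c' : all_moments P f -> all_moments P (fun t => c' * f t).
  by move=> af; apply: all_momentsM => //; exact: all_moments_cst.
rewrite /zonal_moment -!all_moments_RintegralZl// -!all_moments_RintegralD; try exact: aZ;
  last by apply: all_momentsD; exact: aZ.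
move=> h; rewrite (le_trans h)// le_eqVlt; apply/orP; left; apply/eqP.
apply: eq_Rintegral => t _.
pose M k (y : 'I_m.+1 -> R) := Num.sqrt (dot y y) ^+ 5 * (y l ^+ 2 / dot y y) ^+ k.
suff alg y : density y * zonal l k y = A * M k y + B * M k.+1 y + D * M k.+2 y by exact: alg.
rewrite /density /zonal /M; have y0 := dot_ge0 y.
have [d0|d0] := eqVneq (dot y y) 0.
  by rewrite d0 sqrtr0 (expr0n _ 5)/= !(mul0r, mulr0, addr0).
have yE : y l ^+ 2 = y l ^+ 2 / dot y y * dot y y by rewrite divfK.
have yE4 : y l ^+ 4 = (y l ^+ 2 / dot y y * dot y y) ^+ 2 by rewrite -yE -exprM.
rewrite yE4 [in B * _]yE !exprSr.
move: (y l ^+ 2 / dot y y) => v.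
by move: (Num.sqrt (dot y y)) (sqr_sqrtr y0) => r <-; ring.
Qed.

End gaussian.

Hypothesis pole : 1 - (6 * N - 2) * lam - (9 * N ^+ 2 - 12 * N - 1) * lam ^+ 2 < 0.

(** The images of the unit vectors under an embedding form a random vector [xi] with
    [T x = <x, xi>]. *)
Theorem not_embeds_in_L1 : ~ isometric_to_subspace_of_L (1 : R) (@calN R m.+1 lam).
Proof.
case=> T [TL Tlin TN].
have [g gg] := @gaussian_vector_exists R m.+1.
pose xi (i : 'I_m.+1) (t : R) : R := T (delta_mx 0 i) t.
have iT x : P.-integrable setT (EFin \o T x).
  by have /Lfun1_integrable := TL x.
have mT x : measurable_fun setT (T x : R -> R).
  by have /measurable_int/measurable_EFinP := iT x.
(* [T] is linear up to null sets only, so its coordinates determine [T x] almost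
   everywhere for each [x] separately *)
have T0 : T 0 = (fun=> 0) %[ae lebesgue01 R].
  have := Tlin 1 0 0; rewrite scale1r addr0; apply: filterS => t h _.
  by move/eqP: (h I); rewrite mul1r -subr_eq0 opprD addNKr oppr_eq0 => /eqP.
have repr x : T x = (fun t => dot (fun i => x 0 i) (xi^~ t)) %[ae lebesgue01 R].
  rewrite [x in T x]row_sum_delta /dot.
  elim: (index_enum _) => [|i s IH].
    rewrite big_nil; move: T0; apply: filterS => t h _; rewrite big_nil; exact: h.
  rewrite big_cons; have := Tlin (x 0 i) (delta_mx 0 i)
    (\sum_(j <- s) x 0 j *: delta_mx 0 j).
  move: IH; apply: filterS2 => t h1 h2 _.
  by rewrite (h2 I) (h1 I) big_cons.
have xiE x : calN lam x = \int[P]_t `|dot (fun i => x 0 i) (xi^~ t)|.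
  have mdot : measurable_fun setT (fun t => dot (fun i => x 0 i) (xi^~ t)).
    by apply: measurable_sum => i; apply: measurable_funM => //; exact: mT.
  apply: EFin_inj; rewrite -TN Lnorm1.
  transitivity (\int[P]_t (`|dot (fun i => x 0 i) (xi^~ t)|)%:E)%E.
    apply: ae_eq_integral => //.
    - by apply: measurableT_comp => //; apply/measurable_EFinP; exact: mT.
    - by apply/measurable_EFinP; exact: measurableT_comp.
    by have := repr x; apply: filterS => t h _ /=; rewrite (h I).
  rewrite /= /Rintegral fineK//; apply: integrable_fin_num => //.
  have := integrable_combination (fun i => x 0 i) (fun i => iT (delta_mx 0 i)).
  by move=> /integrable_abse.
have ABD_lt0 : A + B + D < 0.
  by rewrite density_pole pmulr_llt0// invr_gt0 !mulr_gt0//; move: N_gt0; lra.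
have [k] := zonal_concentration gg l ABD_lt0.
rewrite ltNge => /negP; apply.
exact: (test_against_representation gg k (fun i => mT _) (fun i => iT _) xiE).
Qed.

End obstruction.

(** * The theorem *)

(** [alpha] is the positive root of the quadratic polynomial in [lam] that gives, up
    to a positive factor, the value of the quartic form at the pole. *)
Lemma alpha_lt_pole (R : realType) (n : nat) (lam : R) :
  (3 <= n)%N -> alpha R n < lam ->
  0 < lam /\
  1 - (6 * n%:R - 2) * lam - (9 * n%:R ^+ 2 - 12 * n%:R - 1) * lam ^+ 2 < 0.
Proof.
move=> n3; have N3 : 3 <= n%:R :> R by rewrite (ler_nat R 3 n).
rewrite /alpha; move: (n%:R : R) N3 => N N3.
have K0 : 0 < 9 * N ^+ 2 - 12 * N - 1 by nra.
rewrite ltr_pdivrMr// => h.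
set s := Num.sqrt _ in h.
have s2 : s ^+ 2 = 18 * N ^+ 2 - 18 * N by rewrite sqr_sqrtr//; nra.
have s0 : 0 <= s := sqrtr_ge0 _.
have s_gt : 3 * N - 1 < s.
  by rewrite -(@ltr_pXn2r _ 2)// ?nnegrE ?s2; nra.
have lam0 : 0 < lam by rewrite -(pmulr_lgt0 _ K0); lra.
split=> //.
have : s ^+ 2 < (lam * (9 * N ^+ 2 - 12 * N - 1) + 3 * N - 1) ^+ 2.
  by rewrite ltr_pXn2r// ?nnegrE; nra.
rewrite s2 -subr_gt0.
rewrite (_ : _ - _ = (9 * N ^+ 2 - 12 * N - 1) *
  ((9 * N ^+ 2 - 12 * N - 1) * lam ^+ 2 + (6 * N - 2) * lam - 1)); last by ring.
by rewrite pmulr_rgt0//; lra.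
Qed.

Theorem theorem1 (R : realType) (n : nat) (hn : (3 <= n)%N) (lam : R)
    (hlam_gt : alpha R n < lam) (hlam_le : lam <= (6 * n%:R - 4)^-1) :
  isometric_to_subspace_of_L (2^-1 : R) (@calN R n lam) /\
  ~ isometric_to_subspace_of_L (1 : R) (@calN R n lam).
Proof.
have [lam_gt0 pole] := @alpha_lt_pole R n lam hn hlam_gt.
case: n hn hlam_gt hlam_le pole => [//|m] _ _ lam_le pole.
by split; [exact: (embeds_in_L_half (ltW lam_gt0))|exact: not_embeds_in_L1].
Qed.
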